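(* Let $\alpha\in(0,1/2)$ be irrational and let $\mathsf f$ be an orientation-preserving $C^\infty$-diffeomorphism of $\mathbb T$ with rotation number $2\alpha$. On $\mathcal H_\omega=\ell^2(\mathbb Z;L^2(\mathbb T,m))$ let $\Delta_\omega$, $J_\omega$, $\mathrm L$, $a_n$, $\delta_n$, and the orthonormal bases $\{e^{kl}\}$, $\{\epsilon^{kl}\}$ be those associated with $\mathsf f$. Then for all $k,l,r,s\in\mathbb Z$, $$\big\langle\Delta_\omega^{-1}\mathrm Le^{kl},e^{rs}\big\rangle=(il-a_k)\,\widehat{1/\delta_k}(s-l)\,\delta_{k,r},$$ $$\big\langle\mathrm L\Delta_\omega^{-1}e^{kl},e^{rs}\big\rangle=(is-a_k)\,\widehat{1/\delta_k}(s-l)\,\delta_{k,r},$$ $$\big\langle\Delta_\omega^{-1/2}\mathrm L\Delta_\omega^{-1/2}\epsilon^{kl},\epsilon^{rs}\big\rangle=-\big(il\,\delta_{l,s}+a_{-k}\,\widehat{\delta_k}(l-s)\big)\,\delta_{k,r}.$$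
   Context: $\mathbb T$ is the unit circle, $m$ its normalised Haar measure, $D=\frac{d}{dz}$ the derivative with respect to $z\in\mathbb T$ (for $z=e^{i\theta}$, $\frac{d}{d\theta}=iz\frac{d}{dz}$), $\mathsf f^n$ ($n\in\mathbb Z$) the iterates of $\mathsf f$. For $g\in L^1(\mathbb T,m)$, $\widehat g(n)=\int_{\mathbb T}g(z)z^{-n}\,dm(z)$. $\delta_{i,j}$ (two indices) is the Kronecker symbol, while $\delta_n$ (one index) is the function $\delta_n(z)=\frac{d(m\circ\mathsf f^n)}{dm}(z)=\frac{z(D\mathsf f^n)(z)}{\mathsf f^n(z)}$, $z\in\mathbb T$, $n\in\mathbb Z$. Inner products are linear in the first variable. On $\mathcal H_\omega=\ell^2(\mathbb Z;L^2(\mathbb T,m))$: the powers ($b\in\mathbb R$) of the modular operator are $(\Delta_\omega^bx)_n(z)=\delta_n(z)^bx_n(z)$ on maximal domains, and the modular conjugation is $(J_\omega x)_n(z)=\delta_n(z)^{1/2}\,\overline{x_{-n}(\mathsf f^n(z))}$. Bases: $e^{kl}_n(z)=z^l\delta_{n,k}$ and $\epsilon^{kl}=J_\omega e^{kl}$, $k,l\in\mathbb Z$. Operator $\mathrm L$: $\Gamma_n(\mathsf f)=\max\{\|D\mathsf f^n\|_\infty,\|D\mathsf f^{-n}\|_\infty\}$, $n=0,1,2,\dots$; $a_0=0$ and for $n\ne0$, $a_n=\operatorname{sign}(n)\sum_{l=1}^{|n|}\frac{1}{\Gamma_{l-\frac{1-\operatorname{sign}(n)}{2}}(\mathsf f)}$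 with $\operatorname{sign}(n)=-1$ for $n<0$ and $1$ for $n\ge0$. $\mathrm L=\bigoplus_{n\in\mathbb Z}\big(iz\frac{d}{dz}-a_nI\big)$, each component having domain $H^1(\mathbb T)=\{g\in AC(\mathbb T):g'\in L^2(\mathbb T,m)\}$. *)

(* Defs.v *)
From HB Require Import structures.
From mathcomp Require Import all_boot all_order all_algebra.
From mathcomp Require Import all_classical all_reals all_analysis.
From mathcomp Require Import measurable_realfun complex.

Set Implicit Arguments.
Unset Strict Implicit.
Unset Printing Implicit Defensive.

Import Order.TTheory GRing.Theory Num.Theory.
Import numFieldNormedType.Exports.
Import ComplexField.Normc complex.

Local Open Scope classical_set_scope.
Local Open Scope ring_scope.
Local Open Scope complex_scope.

Definition complex_display : measure_display.
Proof. exact: default_measure_display. Qed.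

Section ComplexMeasurable.
Variable R : realType.

(* The Borel sets of R[i] are those of R * R under z |-> (Re z, Im z). *)
Definition ReIm (z : R[i]) : R * R := (Re z, Im z).
Definition measurable_complex : set (set R[i]) :=
  preimage_set_system setT ReIm measurable.

Let mc_sa : sigma_algebra setT measurable_complex.
Proof. exact/sigma_algebra_preimage/sigma_algebra_measurable. Qed.

Let mc0 : measurable_complex set0. Proof. by case: mc_sa. Qed.
Let mcC A : measurable_complex A -> measurable_complex (~` A).
Proof. by move=> mA; rewrite -setTD; case: mc_sa => _ + _; exact. Qed.
Let mcU (F : (set R[i])^nat) :
  (forall i, measurable_complex (F i)) -> measurable_complex (\bigcup_i F i).
Proof. by move=> mF; case: mc_sa => _ _; exact. Qed.

HB.instance Definition _ := isPointed.Build R[i] 0.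
HB.instance Definition _ :=
  isMeasurable.Build complex_display R[i] mc0 mcC mcU.

Lemma measurable_ReIm : measurable_fun [set: R[i]] ReIm.
Proof. by move=> _ B mB; exists B. Qed.

Lemma measurable_Re : measurable_fun [set: R[i]] (@Re R).
Proof. exact: (measurableT_comp (@measurable_fst _ _ R R) measurable_ReIm). Qed.

Lemma measurable_Im : measurable_fun [set: R[i]] (@Im R).
Proof. exact: (measurableT_comp (@measurable_snd _ _ R R) measurable_ReIm). Qed.

Lemma measurable_complexP d (T : measurableType d) (f : T -> R[i]) :
  measurable_fun setT f <->
  measurable_fun setT (fun x => Re (f x)) /\
  measurable_fun setT (fun x => Im (f x)).
Proof.
split=> [mf|[mRe mIm] _ _ [B mB <-]].
  by split; [exact: (measurableT_comp measurable_Re)|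
             exact: (measurableT_comp measurable_Im)].
have := measurable_fun_pair mRe mIm measurableT mB.
by rewrite !setTI.
Qed.

Lemma measurable_normc : measurable_fun [set: R[i]] (@normc R).
Proof.
rewrite (_ : @normc R = fun z => Num.sqrt (Re z ^+ 2 + Im z ^+ 2)); last first.
  by apply/funext => -[].
apply: (measurableT_comp (continuous_measurable_fun (@sqrt_continuous R))).
by apply: measurable_funD; apply: measurable_funX;
  [exact: measurable_Re|exact: measurable_Im].
Qed.

End ComplexMeasurable.

Definition circle_display : measure_display.
Proof. exact: default_measure_display. Qed.

Section Circle.
Variable R : realType.

Record circle := Circle { circle_val :> R[i] ; _ : `|circle_val| == 1 }.

HB.instance Definition _ := [isSub for circle_val].
HB.instance Definition _ := [Choice of circle by <:].

Let expi_subproof (t : R) : `|cos t +i* sin t| == 1.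
Proof. by rewrite normc_def /= cos2Dsin2 sqrtr1. Qed.

Definition expi (t : R) : circle := Circle (expi_subproof t).

Let cmul_subproof (z w : circle) : `|(z : R[i]) * w| == 1.
Proof. by rewrite normrM (eqP (valP z)) (eqP (valP w)) mulr1. Qed.

Definition cmul (z w : circle) : circle := Circle (cmul_subproof z w).

Definition measurable_circle : set (set circle) :=
  preimage_set_system setT circle_val measurable.

Let mc_sa : sigma_algebra setT measurable_circle.
Proof. exact/sigma_algebra_preimage/sigma_algebra_measurable. Qed.

Let mc0 : measurable_circle set0. Proof. by case: mc_sa. Qed.
Let mcC A : measurable_circle A -> measurable_circle (~` A).
Proof. by move=> mA; rewrite -setTD; case: mc_sa => _ + _; exact. Qed.
Let mcU (F : (set circle)^nat) :
  (forall i, measurable_circle (F i)) -> measurable_circle (\bigcup_i F i).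
Proof. by move=> mF; case: mc_sa => _ _; exact. Qed.

HB.instance Definition _ := isPointed.Build circle (expi 0).
HB.instance Definition _ :=
  isMeasurable.Build circle_display circle mc0 mcC mcU.

Lemma measurable_circle_val : measurable_fun [set: circle] circle_val.
Proof. by move=> _ B mB; exists B. Qed.

Lemma measurable_expi : measurable_fun [set: R] expi.
Proof.
move=> _ _ [B mB <-]; rewrite (setTI (circle_val @^-1` B)).
suff mf : measurable_fun [set: R] (circle_val \o expi) by exact: mf.
apply/measurable_complexP; split; apply: continuous_measurable_fun.
- exact: continuous_cos.
- exact: continuous_sin.
Qed.

(* The same map, out of the copy of R that carries lebesgue_measure. *)
Definition expi_mfun : measurableTypeR R -> circle := expi.

HB.instance Definition _ :=
  isMeasurableFun.Build _ _ (measurableTypeR R) circle expi_mfun measurable_expi.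

Lemma twopi_gt0 : 0 < 2 * pi :> R.
Proof. by rewrite mulr_gt0 ?pi_gt0. Qed.

(* Normalised Haar measure: the law of exp(i t), t uniform on [0, 2 pi]. *)
Definition haar : probability circle R :=
  distribution (uniform_prob twopi_gt0) expi_mfun.

Definition cint (g : circle -> R[i]) : R[i] :=
  (\int[haar]_(z in setT) Re (g z)) +i* (\int[haar]_(z in setT) Im (g z)).

Definition fourier (g : circle -> R[i]) (n : int) : R[i] :=
  cint (fun z => g z * (z : R[i]) ^ (- n)).

Definition sqnorm (g : circle -> R[i]) : \bar R :=
  (\int[haar]_z (normc (g z) ^+ 2)%:E)%E.

End Circle.
Arguments haar {R}.

Section Derivative.
Variable R : realType.

Definition derivC (u : R -> R[i]) (t : R) : R[i] :=
  derive1 (fun x => Re (u x)) t +i* derive1 (fun x => Im (u x)) t.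

(* d/dtheta at z = exp(i theta), then D = d/dz = (i z)^-1 d/dtheta. *)
Definition dtheta (g : circle R -> R[i]) (z : circle R) : R[i] :=
  derivC (fun t => g (cmul z (expi t))) 0.

Definition dz (g : circle R -> R[i]) (z : circle R) : R[i] :=
  ('i%C * (z : R[i]))^-1 * dtheta g z.

Definition smooth (g : circle R -> R[i]) : Prop :=
  forall (n : nat) (t : R),
    derivable (derive1n n (fun x => Re (g (expi x)))) t 1 /\
    derivable (derive1n n (fun x => Im (g (expi x)))) t 1.

Definition abs_cont (a b : R) (u : R -> R[i]) : Prop :=
  forall eps : R, 0 < eps -> exists2 delta : R, 0 < delta &
    forall (n : nat) (x y : 'I_n -> R),
      (forall i, [/\ a <= x i, x i <= y i & y i <= b]) ->
      trivIset setT (fun i => `]x i, y i[%classic) ->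
      \sum_i (y i - x i) < delta ->
      \sum_i normc (u (y i) - u (x i)) < eps.

Definition AC (g : circle R -> R[i]) : Prop :=
  abs_cont 0 (2 * pi) (fun t => g (expi t)).

End Derivative.

Section Diffeo.
Variable R : realType.

Record circle_diffeo := CircleDiffeo {
  dfun :> circle R -> circle R ;
  dinv : circle R -> circle R ;
  dfunK : cancel dfun dinv ;
  dinvK : cancel dinv dfun ;
  dfun_smooth : smooth (fun z => dfun z) ;
  dinv_smooth : smooth (fun z => dinv z) }.

Definition is_lift (f : circle R -> circle R) (F : R -> R) : Prop :=
  continuous F /\ forall x, f (expi (2 * pi * x)) = expi (2 * pi * F x).

Definition orientation_preserving (f : circle R -> circle R) : Prop :=
  exists2 F, is_lift f F & {homo F : x y / x < y}.

(* The rotation number lives in R / Z: adding an integer to the lift adds it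
   to the limit, so rho is a representative iff some lift has limit rho. *)
Definition has_rotation_number (f : circle R -> circle R) (rho : R) : Prop :=
  exists2 F, is_lift f F &
    forall x, (iter n F x - x) / n%:R @[n --> \oo] --> rho.

Variable f : circle_diffeo.

Definition iterz (n : int) : circle R -> circle R :=
  match n with
  | Posz p => iter p f
  | Negz p => iter p.+1 (dinv f)
  end.

Definition diterz (n : int) (z : circle R) : R[i] :=
  dz (fun w => iterz n w) z.

(* z (D f^n)(z) / f^n(z) is real, and positive if f preserves orientation. *)
Definition delta (n : int) (z : circle R) : R :=
  Re ((z : R[i]) * diterz n z / (iterz n z : R[i])).

Definition supnorm (g : circle R -> R[i]) : R :=
  sup (range (fun z => normc (g z))).

Definition growth (n : nat) : R :=
  Num.max (supnorm (diterz n%:Z)) (supnorm (diterz (- n%:Z))).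

(* l - (1 - sign n) / 2 is l for n >= 0 and l - 1 for n < 0. *)
Definition acoef (n : int) : R :=
  (-1) ^+ (n < 0)%R *
  \sum_(1 <= l < `|n|%N.+1) (growth (l - (n < 0)%R)%N)^-1.

End Diffeo.

Section Hilbert.
Variable R : realType.

(* L^2(circle; C): square integrable measurable functions modulo equality
   haar-almost everywhere. *)
Record L2 := MkL2 {
  L2val :> {mfun_ (@haar R), circle R >-> R[i]} ;
  L2fin : (sqnorm L2val < +oo)%E }.

Lemma sqnorm_ae (g h : circle R -> R[i]) :
  measurable_fun setT g -> measurable_fun setT h -> g = h %[ae haar] ->
  sqnorm g = sqnorm h.
Proof.
move=> mg mh gh; apply: ge0_ae_eq_integral => //.
- apply/measurable_EFinP; apply: measurable_funX.
  exact: (measurableT_comp (@measurable_normc R)).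
- apply/measurable_EFinP; apply: measurable_funX.
  exact: (measurableT_comp (@measurable_normc R)).
- by move=> z _; rewrite lee_fin sqr_ge0.
- by move=> z _; rewrite lee_fin sqr_ge0.
- by apply: filterS gh => z + _ => ->.
Qed.

Definition ae_class (g : {mfun circle R >-> R[i]}) :
    {mfun_ (@haar R), circle R >-> R[i]} :=
  (\pi g)%qT.

Lemma ae_classE (g : {mfun circle R >-> R[i]}) : ae_class g = g %[ae haar].
Proof.
have : (repr (ae_class g) == g %[mod {mfun_ (@haar R), circle R >-> R[i]}])%qT.
  by rewrite reprK.
by rewrite eqmodE => /asboolP.
Qed.

Lemma sqnorm_ae_class (g : {mfun circle R >-> R[i]}) :
  sqnorm (ae_class g) = sqnorm g.
Proof. by apply: sqnorm_ae => //; exact: ae_classE. Qed.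

Lemma measurable_complexM (g h : circle R -> R[i]) :
  measurable_fun setT g -> measurable_fun setT h ->
  measurable_fun setT (fun z => g z * h z).
Proof.
move=> /measurable_complexP[g1 g2] /measurable_complexP[h1 h2].
apply/measurable_complexP; split.
- rewrite (_ : (fun z => _) =
    fun z => Re (g z) * Re (h z) - Im (g z) * Im (h z)).
    by apply: measurable_funB; exact: measurable_funM.
  by apply/funext => z; case: (g z) (h z) => [? ?] [].
- rewrite (_ : (fun z => _) =
    fun z => Re (g z) * Im (h z) + Im (g z) * Re (h z)).
    by apply: measurable_funD; exact: measurable_funM.
  by apply/funext => z; case: (g z) (h z) => [? ?] [].
Qed.

Lemma circle_invE (z : circle R) : (z : R[i])^-1 = conjc (z : R[i]).
Proof.
have zu : (z : R[i]) * conjc (z : R[i]) = 1.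
  by rewrite -sqr_normc (eqP (valP z)) expr1n.
apply: (@mulfI _ (z : R[i])).
  by apply: contra_eq_neq zu => ->; rewrite mul0r eq_sym oner_neq0.
rewrite zu divff //.
by apply: contra_eq_neq zu => ->; rewrite mul0r eq_sym oner_neq0.
Qed.

Lemma measurable_exprz (l : int) :
  measurable_fun [set: circle R] (fun z => (z : R[i]) ^ l).
Proof.
have mX (g : circle R -> R[i]) n : measurable_fun setT g ->
    measurable_fun setT (fun z => g z ^+ n).
  move=> mg; elim: n => [|n IHn]; first exact: measurable_cst.
  under eq_fun do rewrite exprS.
  exact: measurable_complexM.
have mz := @measurable_circle_val R.
case: l => n; first exact: mX.
rewrite (_ : (fun z => _) = fun z : circle R => conjc (z : R[i]) ^+ n.+1).
  apply: mX; have /measurable_complexP[mRe mIm] := mz.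
  apply/measurable_complexP; split.
  - by rewrite (_ : (fun z => _) = fun z : circle R => Re (z : R[i]))//;
      apply/funext => -[[]].
  - rewrite (_ : (fun z => _) = fun z : circle R => - Im (z : R[i])).
      exact: measurableT_comp.
    by apply/funext => -[[]].
by apply/funext => z; rewrite -circle_invE exprVn.
Qed.

Definition basis_fun (k l n : int) (z : circle R) : R[i] :=
  (z : R[i]) ^ l * (n == k)%:R.

Lemma measurable_basis_fun k l n : measurable_fun setT (basis_fun k l n).
Proof.
by apply: measurable_complexM; [exact: measurable_exprz|exact: measurable_cst].
Qed.

HB.instance Definition _ k l n := isMeasurableFun.Build _ _ _ _
  (basis_fun k l n) (@measurable_basis_fun k l n).

Lemma sqnorm_basis_fun k l n : sqnorm (basis_fun k l n) = (n == k)%:R%:E.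
Proof.
rewrite /sqnorm (_ : (fun z => _) = cst (n == k)%:R%:E).
  by rewrite integral_cst// [X in (_ * X)%E]probability_setT mule1.
apply/funext => z /=; congr EFin.
have nE (w : R[i]) : `|w| = (normc w)%:C by case: w => a b; rewrite normc_def.
apply: (@complexI R); rewrite rmorphXn /= -nE /basis_fun normrM.
have -> : `|(z : R[i]) ^ l| = 1.
  by case: l => m; rewrite /exprz ?normfV normrX (eqP (valP z)) expr1n ?invr1.
rewrite mul1r.
by case: (n == k); rewrite ?normr1 ?normr0 ?expr1n ?expr0n.
Qed.

Lemma basis_fin k l n :
  (sqnorm (ae_class (basis_fun k l n)) < +oo)%E.
Proof. by rewrite sqnorm_ae_class sqnorm_basis_fun ltry. Qed.

Record Hw := MkHw {
  Hwval :> int -> L2 ;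
  Hwfin : (\esum_(n in [set: int]) sqnorm (Hwval n) < +oo)%E }.

HB.instance Definition _ := gen_eqMixin Hw.
HB.instance Definition _ := gen_choiceMixin Hw.

Lemma basis_summable k l :
  (\esum_(n in [set: int]) sqnorm (MkL2 (basis_fin k l n)) < +oo)%E.
Proof.
under eq_esum do rewrite /= sqnorm_ae_class sqnorm_basis_fun.
rewrite (esumID [set k]); last by move=> n _; rewrite lee_fin.
rewrite setTI esum_set1 ?lee_fin// eqxx esum1 ?adde0 ?ltry//.
by move=> n [_ /= /eqP /negPf ->].
Qed.

(* e^{kl} *)
Definition ebasis (k l : int) : Hw := MkHw (basis_summable k l).

Definition innerL2 (u v : L2) : R[i] := cint (fun z => u z * conjc (v z)).

(* Sum over Z of the (absolutely summable) family <x_n, y_n>. *)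
Definition innerHw (x y : Hw) : R[i] :=
  let c (N : nat) : R[i] :=
    \sum_(i < N.*2.+1) innerL2 (x (i%:Z - N%:Z)) (y (i%:Z - N%:Z)) in
  limn (fun N => Re (c N)) +i* limn (fun N => Im (c N)).

(* An unbounded operator is given by its graph. *)
Definition operator (E : Type) := set (E * E).

Definition opdom (E : Type) (A : operator E) : set E :=
  [set x | exists y, A (x, y)].

Definition opcomp (E : Type) (A B : operator E) : operator E :=
  [set p | exists2 y, B (p.1, y) & A (y, p.2)].

(* Meant for x in the domain of A; the value x elsewhere is irrelevant. *)
Definition opapp (E : choiceType) (A : operator E) (x : E) : E :=
  xget x [set y | A (x, y)].

(* Componentwise operator on its maximal domain in Hw. *)
Definition dirsum (A : int -> operator L2) : operator Hw :=
  [set p : Hw * Hw | forall n, A n (p.1 n, p.2 n)].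

Definition mulop (h : circle R -> R[i]) : operator L2 :=
  [set p : L2 * L2 | p.2 = (fun z => h z * p.1 z) %[ae haar]].

(* H^1(circle): absolutely continuous g with (a.e. defined) g' in L^2. *)
Definition H1 (g : circle R -> R[i]) : Prop :=
  AC g /\ exists v : L2, v = dz g %[ae haar].

(* i z d/dz - a on H^1(circle), on L^2-classes through their continuous
   representative g. *)
Definition dirac_comp (a : R) : operator L2 :=
  [set p : L2 * L2 | exists g, [/\ H1 g, p.1 = g %[ae haar] &
    p.2 = (fun z : circle R => 'i%C * (z : R[i]) * dz g z - a%:C * g z) %[ae haar]]].

Variable f : circle_diffeo R.

Definition modop (b : R) : operator Hw :=
  dirsum (fun n => mulop (fun z => (delta f n z `^ b)%:C)).

Definition modconj : operator Hw :=
  [set p : Hw * Hw | forall n : int, p.2 n =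
    (fun z => (delta f n z `^ 2^-1)%:C * conjc (p.1 (- n) (iterz f n z)))
      %[ae haar]].

Definition Lop : operator Hw := dirsum (fun n => dirac_comp (acoef f n)).

(* epsilon^{kl} *)
Definition epsbasis (k l : int) : Hw := opapp modconj (ebasis k l).

End Hilbert.

(* Main.v *)
Require Import Defs.
From mathcomp Require Import all_boot all_order all_algebra.
From mathcomp Require Import all_classical all_reals all_analysis.
From mathcomp Require Import measurable_realfun complex ring lra zify.

Set Implicit Arguments.
Unset Strict Implicit.
Unset Printing Implicit Defensive.

Import Order.TTheory GRing.Theory Num.Theory.
Import numFieldNormedType.Exports.

Local Open Scope ring_scope.

(* Put f (e^it) = e^iH(t) with H smooth and strictly increasing. Every iterate
   h = f^n lifts in this way, and z (Dh)(z) / h(z) = H'(t) at z = e^it, so that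
   delta_n is a positive C^1 function. All the vectors involved have a single
   nonzero component, which is C^1, and each matrix coefficient becomes one
   integral over the circle. The first one is immediate, the second one is an
   integration by parts, and the third one follows from
   epsilon^{kl}_{-k} = delta_{-k}^{1/2} (f^{-k})^{-l} and the change of variables
   z -> f^{-k}(z).
   Since the components are classes modulo null sets, two facts are needed on
   top of the calculus: a diffeomorphism pulls null sets back to null sets
   (otherwise x_{-n} o f^n makes no sense), and a class has at most one
   absolutely continuous representative (otherwise L is not a function). *)

(** Operators are graphs on almost-everywhere classes and [opapp] picks a value by choice. Each
    operator is therefore characterised by an equivalence on vectors with one nonzero component: one
    direction puts the vector in the domain, the other determines the chosen value up to null sets,
    which is all that the inner product sees. Once continuous representatives are in place, an
    integral over the circle is the increment of a primitive over one period, so that linearity,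
    integration by parts and the change of variables reduce to rules for derivatives. The lift of
    [f] is given as continuous and increasing only; its regularity has to be extracted from that of
    cos H and sin H, and the positivity of H' from the smoothness of the inverse. C^2 lifts are the
    right class: they make delta_k^-1 z^l a C^1 function, hence an element of the domain of L. *)

(** * Derivatives and continuity of complex functions of a real variable *)

Section ComplexCalculus.
Variable R : realType.
Import ComplexField.Normc complex.
Local Open Scope complex_scope.
Implicit Types (u v : R -> R[i]) (t : R).

(** Componentwise, because [derivC] and [smooth] are themselves stated through real and imaginary
    parts. *)
Definition is_deriveC u t (c : R[i]) : Prop :=
  is_derive t 1 (fun x => Re (u x)) (Re c) /\
  is_derive t 1 (fun x => Im (u x)) (Im c).

Definition continuousC u : Prop :=
  continuous (fun x => Re (u x)) /\ continuous (fun x => Im (u x)).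

Lemma is_deriveC_cst (c : R[i]) t : is_deriveC (fun=> c) t 0.
Proof. by split; exact: is_derive_cst. Qed.

Lemma is_deriveCD u v t c d : is_deriveC u t c -> is_deriveC v t d ->
  is_deriveC (fun x => u x + v x) t (c + d).
Proof.
move=> [u1 u2] [v1 v2]; split.
- rewrite (_ : (fun x => _) = (fun x => Re (u x)) + (fun x => Re (v x)))%R.
    by rewrite raddfD; exact: is_deriveD.
  by apply/funext => x; rewrite raddfD.
- rewrite (_ : (fun x => _) = (fun x => Im (u x)) + (fun x => Im (v x)))%R.
    by rewrite raddfD; exact: is_deriveD.
  by apply/funext => x; rewrite raddfD.
Qed.

Lemma ReM (a b : R[i]) : Re (a * b) = Re a * Re b - Im a * Im b.
Proof. by case: a b => [? ?] []. Qed.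

Lemma ImM (a b : R[i]) : Im (a * b) = Re a * Im b + Im a * Re b.
Proof. by case: a b => [? ?] []. Qed.

Lemma normc_le_ReIm (a : R[i]) : normc a <= `|Re a| + `|Im a|.
Proof.
case: a => a b /=.
rewrite -(ler_pXn2r (n := 2)) ?nnegrE ?sqrtr_ge0 ?addr_ge0//.
rewrite sqr_sqrtr ?addr_ge0 ?sqr_ge0// sqrrD !real_normK ?num_real//.
by rewrite lerD2r lerDl mulrn_wge0// mulr_ge0.
Qed.

Lemma ReIm_le_normc (a : R[i]) : `|Re a| <= normc a /\ `|Im a| <= normc a.
Proof.
case: a => a b /=; rewrite -!sqrtr_sqr; split.
- by rewrite ler_wsqrtr// lerDl sqr_ge0.
- by rewrite ler_wsqrtr// lerDr sqr_ge0.
Qed.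

Lemma is_deriveCM u v t c d : is_deriveC u t c -> is_deriveC v t d ->
  is_deriveC (fun x => u x * v x) t (c * v t + u t * d).
Proof.
move=> [u1 u2] [v1 v2]; split.
- rewrite (_ : (fun x => _) = ((fun x => Re (u x)) * (fun x => Re (v x)))
     - ((fun x => Im (u x)) * (fun x => Im (v x)))).
    apply: is_derive_eq; rewrite [in RHS]raddfD/= !ReM /GRing.scale/=; ring.
  by apply/funext => x; rewrite ReM.
- rewrite (_ : (fun x => _) = ((fun x => Re (u x)) * (fun x => Im (v x)))
     + ((fun x => Im (u x)) * (fun x => Re (v x)))).
    apply: is_derive_eq; rewrite [in RHS]raddfD/= !ImM /GRing.scale/=; ring.
  by apply/funext => x; rewrite ImM.
Qed.

Lemma is_deriveC_real (k : R -> R) t c :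
  is_derive t 1 k c -> is_deriveC (fun x => (k x)%:C) t c%:C.
Proof. by move=> dk; split => //=; exact: is_derive_cst. Qed.

Lemma is_deriveC_comp u (k : R -> R) t c d :
  is_deriveC u (k t) c -> is_derive t 1 k d ->
  is_deriveC (fun x => u (k x)) t (d%:C * c).
Proof.
move=> [u1 u2] dk; split.
- have := @is_derive1_comp _ (fun x => Re (u x)) k t _ _ u1 dk.
  by move=> h; apply: is_derive_eq; rewrite ReM/= mul0r subr0 mulrC.
- have := @is_derive1_comp _ (fun x => Im (u x)) k t _ _ u2 dk.
  by move=> h; apply: is_derive_eq; rewrite ImM/= mul0r addr0 mulrC.
Qed.

Lemma is_deriveC_continuous u v :
  (forall t, is_deriveC u t (v t)) -> continuousC u.
Proof.
move=> du; split=> t; have [d1 d2] := du t;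
  by apply: differentiable_continuous; apply/derivable1_diffP; exact: ex_derive.
Qed.

Lemma is_deriveC_expi t : is_deriveC (fun x => expi x) t ('i%C * (expi t : R[i])).
Proof.
split=> /=.
- by apply: is_derive_eq (is_derive_cos t) _; ring.
- by apply: is_derive_eq (is_derive_sin t) _; ring.
Qed.

Lemma continuousC_cst c : continuousC (fun=> c).
Proof. by split=> x; exact: cst_continuous. Qed.

Lemma continuousCD u v :
  continuousC u -> continuousC v -> continuousC (fun x => u x + v x).
Proof.
move=> [u1 u2] [v1 v2]; split.
- rewrite (_ : (fun x => _) = (fun x => Re (u x) + Re (v x))).
    by move=> x; apply: cvgD; [exact: u1|exact: v1].
  by apply/funext => x; rewrite raddfD.
- rewrite (_ : (fun x => _) = (fun x => Im (u x) + Im (v x))).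
    by move=> x; apply: cvgD; [exact: u2|exact: v2].
  by apply/funext => x; rewrite raddfD.
Qed.

Lemma continuousCM u v :
  continuousC u -> continuousC v -> continuousC (fun x => u x * v x).
Proof.
move=> [u1 u2] [v1 v2]; split.
- under eq_fun do rewrite ReM.
  by move=> x; apply: cvgB; apply: cvgM; 
    (exact: u1 || exact: v1 || exact: u2 || exact: v2).
- under eq_fun do rewrite ImM.
  by move=> x; apply: cvgD; apply: cvgM; 
    (exact: u1 || exact: v1 || exact: u2 || exact: v2).
Qed.

Lemma continuousC_real (k : R -> R) :
  continuous k -> continuousC (fun x => (k x)%:C).
Proof. by move=> ck; split=> //= x; exact: cst_continuous. Qed.

Lemma continuousC_conj u : continuousC u -> continuousC (fun x => conjc (u x)).
Proof.
move=> [u1 u2]; split.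
  rewrite (_ : (fun x => _) = fun x => Re (u x))//.
  by apply/funext => x; case: (u x).
rewrite (_ : (fun x => _) = (fun x => - Im (u x))).
  by move=> x; apply: cvgN; exact: u2.
by apply/funext => x; case: (u x).
Qed.

Lemma continuousC_comp u (k : R -> R) :
  continuousC u -> continuous k -> continuousC (fun x => u (k x)).
Proof.
move=> [u1 u2] ck; split=> x.
- exact: (continuous_comp (ck x) (u1 (k x))).
- exact: (continuous_comp (ck x) (u2 (k x))).
Qed.

Lemma continuousC_expi : continuousC (fun x => expi x).
Proof. exact: is_deriveC_continuous is_deriveC_expi. Qed.

End ComplexCalculus.

(** * The exponential parametrisation of the circle *)

Section ExpI.
Variable R : realType.
Import ComplexField.Normc complex.
Local Open Scope complex_scope.
Implicit Types (s t : R) (z : circle R).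

Lemma expiD s t : expi (s + t) = cmul (expi s) (expi t).
Proof.
apply/val_inj/eqP; rewrite eq_complex /= cosD sinD.
by rewrite eqxx addrC eqxx.
Qed.

Lemma expiDE s t : expi (s + t) = (expi s : R[i]) * expi t :> R[i].
Proof. by rewrite expiD. Qed.

Lemma circle_neq0 z : (z : R[i]) != 0.
Proof. by rewrite -normr_eq0 (eqP (valP z)) oner_neq0. Qed.

(** De Moivre for all integers: powers of z, negative ones included, become reparametrisations of
    [expi], and the calculus of [expi] alone handles them. *)
Lemma expi_exp t (m : int) : (expi t : R[i]) ^ m = expi (m%:~R * t).
Proof.
have expiN s : (expi (- s) : R[i]) = (expi s : R[i])^-1.
  by rewrite circle_invE /= cosN sinN.
have H n : (expi t : R[i]) ^+ n = expi (n%:R * t).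
  elim: n => [|n IH]; last by rewrite exprS IH -expiDE -natr1 mulrDl mul1r addrC.
  by rewrite mul0r /= cos0 sin0.
case: m => n; first by rewrite -exprnP H pmulrn.
by rewrite NegzE -exprnN mulrNz mulNr expiN H pmulrn.
Qed.

Lemma expiD2pi t (n : int) : expi (t + 2 * pi * n%:~R) = expi t.
Proof.
apply/val_inj; rewrite [LHS]expiDE [2 * pi * _]mulrC -expi_exp.
suff -> : (expi (2 * pi) : R[i]) = 1 by rewrite exp1rz mulr1.
by rewrite /= mulr_natl cos2pi sin2pi.
Qed.

Lemma periodic_expi t : expi (t + 2 * pi) = expi t.
Proof. by have := expiD2pi t 1; rewrite mulr1. Qed.

Lemma i_neq0 : 'i%C != 0 :> R[i].
Proof. by rewrite eq_complex /= oner_eq0 andbF. Qed.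

End ExpI.

(** * A measurable argument, and functions read in the angle *)

Section CircleArgument.
Variable R : realType.
Import ComplexField.Normc complex.
Local Open Scope complex_scope.
Local Open Scope classical_set_scope.
Implicit Types (s t : R) (z : circle R).

(** A section of [expi] with values in [-pi, pi]. Through it, pointwise claims on the circle are
    checked at points e^it, and measurability is read off functions of the angle. *)
Definition carg z : R := if 0 <= Im z then acos (Re z) else - acos (Re z).

Lemma circle_ReIm z : Re z ^+ 2 + Im z ^+ 2 = 1.
Proof.
case: z => -[a b] /= /eqP; rewrite normc_def /= => -[h].
have : 0 <= a ^+ 2 + b ^+ 2 by rewrite addr_ge0 ?sqr_ge0.
by move=> /sqr_sqrtr <-; rewrite h expr1n.
Qed.

Lemma circle_Re_itv z : -1 <= Re z <= 1.
Proof.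
by have := circle_ReIm z; have := sqr_ge0 (Im z); nra.
Qed.

Lemma expi_carg z : expi (carg z) = z.
Proof.
have zI := circle_Re_itv z.
have sE : sin (acos (Re z)) = `|Im z|.
  rewrite sin_acos// -sqrtr_sqr; congr Num.sqrt.
  by rewrite -(circle_ReIm z) addrC addKr.
apply/val_inj/eqP; rewrite eq_complex /= /carg; case: ifPn => Iz.
  by rewrite acosK ?in_itv//= sE ger0_norm// !eqxx.
rewrite cosN sinN acosK ?in_itv//= sE ltr0_norm ?opprK ?eqxx//.
by rewrite ltNge.
Qed.

Lemma measurable_carg : measurable_fun [set: circle R] carg.
Proof.
have /measurable_complexP[mRe mIm] := @measurable_circle_val R.
have macos : measurable_fun [set: circle R] (fun z : circle R => acos (Re z)).
  (* acos has junk values off [-1, 1]: clamping makes it monotone on R. *)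
  pose c x : R := Num.max (-1) (Num.min 1 x).
  have cI x : -1 <= c x <= 1.
    by rewrite /c le_max lexx ge_max ge_min lexx /= andbT; lra.
  rewrite (_ : (fun z => _) = (fun x => acos (c x)) \o (fun z : circle R => Re z)).
    apply: (measurableT_comp _ mRe); apply: nonincreasing_measurable => // x y xy.
    have [x1 x2] := acos_def (cI x); have [y1 y2] := acos_def (cI y).
    rewrite leNgt; apply/negP => h.
    have := @ltr_cos R (acos (c x)) (acos (c y)).
    rewrite !in_itv/= x1 y1 => /(_ isT isT).
    rewrite x2 y2 h => /idP; rewrite ltNge => /negP[].
    by rewrite /c ge_max !le_max !le_min !ge_min !lexx xy !orbT.
  apply/funext => z /=; rewrite /c; have /andP[z1 z2] := circle_Re_itv z.
  by rewrite min_r// max_r.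
apply: measurable_fun_ifT => //.
- apply: (measurable_fun_ler (f := cst 0)) => //.
- exact: measurableT_comp.
Qed.

(** Reduced modulo 2 pi to u in [0, 2 pi[, the angle satisfies cos u = 1. Strict monotonicity of cos
    on [0, pi] forces u = 0; values beyond pi are reflected by u -> 2 pi - u. *)
Lemma expi_eq1 t : expi t = expi 0 -> exists n : int, t = 2 * pi * n%:~R.
Proof.
move=> t0; pose n := Num.floor (t / (2 * pi)); exists n.
have tp := twopi_gt0 R.
pose u := t - 2 * pi * n%:~R.
have /andP[n1 n2] := floor_itv (t / (2 * pi)); rewrite -/n in n1 n2.
have u0 : 0 <= u by rewrite subr_ge0 mulrC -ler_pdivlMr.
have u2 : u < 2 * pi.
  rewrite /u ltrBlDr -[X in X + _]mulr1 -mulrDr mulrC -ltr_pdivrMr//.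
  by rewrite addrC -intrD1.
have : cos u = 1.
  have : expi u = expi 0 by rewrite -t0 /u -mulrN -mulrNz expiD2pi.
  by move=> /(congr1 (fun z : circle R => Re z)) /=; rewrite cos0.
move=> cu; apply/eqP; rewrite -subr_eq0 -/u; apply/eqP.
have pp := pi_gt0 R.
apply/eqP; rewrite eq_le u0 andbT leNgt; apply/negP => up.
have [ul|ul] := leP u pi.
  have := @ltr_cos R 0 u; rewrite !in_itv/= ul u0 lexx (ltW pp) => /(_ isT isT).
  by rewrite cu cos0 ltxx up.
have := @ltr_cos R 0 (2 * pi - u); rewrite !in_itv/= lexx (ltW pp).
rewrite mulr_natl cosB cos2pi sin2pi mul0r addr0 mul1r cu cos0 ltxx.
rewrite -mulr_natl.
have -> : 0 <= 2 * pi - u <= pi by lra.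
by move=> /(_ isT isT); lra.
Qed.

Lemma expi_eq s t : expi s = expi t ->
  exists n : int, s = t + 2 * pi * n%:~R.
Proof.
move=> st; have [|n nE] := @expi_eq1 (s - t).
  by rewrite expiD st -expiD subrr.
by exists n; rewrite -nE addrC subrK.
Qed.

(** The factorisation of g as (g o [expi]) o [carg] composes a continuous function with a measurable
    one. *)
Lemma measurable_circle_fun (g : circle R -> R[i]) :
  continuousC (fun t => g (expi t)) -> measurable_fun setT g.
Proof.
move=> [g1 g2]; apply/measurable_complexP.
split.
- rewrite (_ : (fun z => _) = (fun t => Re (g (expi t))) \o carg).
    apply: measurableT_comp measurable_carg.
    exact: continuous_measurable_fun.
  by apply/funext => z /=; rewrite expi_carg.
- rewrite (_ : (fun z => _) = (fun t => Im (g (expi t))) \o carg).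
    apply: measurableT_comp measurable_carg.
    exact: continuous_measurable_fun.
  by apply/funext => z /=; rewrite expi_carg.
Qed.

Lemma carg_itv z : - pi <= carg z <= pi.
Proof.
have /acos_def [/andP[a0 a1] _] := circle_Re_itv z.
by rewrite /carg; case: ifP; lra.
Qed.

Lemma continuous_bounded (v : R -> R) : continuous v ->
  exists M : R, forall t, - pi <= t <= pi -> `|v t| <= M.
Proof.
move=> cv.
have pp := pi_gt0 R.
have cnv : {within `[- pi, pi], continuous (fun t => `|v t|)}.
  apply: continuous_subspaceT => t.
  exact: (continuous_comp (cv t) (@norm_continuous _ _ (v t))).
have [|c _ cM] := EVT_max _ cnv; first by lra.
by exists `|v c| => t tI; apply: cM; rewrite in_itv.
Qed.

Lemma circle_fun_bounded (g : circle R -> R[i]) :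
  continuousC (fun t => g (expi t)) ->
  exists2 M : R, 0 <= M & forall z, normc (g z) <= M.
Proof.
move=> [/continuous_bounded[M1 h1] /continuous_bounded[M2 h2]].
have h z : normc (g z) <= M1 + M2.
  apply: le_trans (normc_le_ReIm _) _; rewrite -(expi_carg z).
  by apply: lerD; [exact: h1 (carg_itv z)|exact: h2 (carg_itv z)].
exists (M1 + M2) => //; apply: le_trans (h (expi 0)).
by case: (g _) => a b /=; exact: sqrtr_ge0.
Qed.

End CircleArgument.

(** * Integrals over the circle through primitives *)

Section CircleIntegral.
Variable R : realType.
Import ComplexField.Normc complex.
Local Open Scope complex_scope.
Local Open Scope classical_set_scope.
Implicit Types (g h : circle R -> R[i]).

Lemma derive0_cst (f : R -> R) (a x y : R) :
  (forall t, a < t -> is_derive t 1 f 0) -> a < x -> a < y -> f x = f y.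
Proof.
move=> df; wlog xy : x y / x < y.
  move=> H ax ay; have [/H->//|/H->//|->//] := ltgtP x y.
move=> ax _; have [t|t|c _] := @MVT _ f (fun=> 0) x y xy.
- by rewrite in_itv/= => /andP[xt _]; apply: df; exact: lt_trans xt.
- apply: derivable_within_continuous => {}t; rewrite in_itv/= => /andP[xt _].
  exact: @ex_derive _ _ _ _ _ _ _ (df t (lt_le_trans ax xt)).
by rewrite mul0r => /eqP; rewrite subr_eq0 => /eqP.
Qed.

(** The integral from a is claimed to be a primitive only to the right of a. Hence the primitives
    used below live on half-lines starting to the left of the period. *)
Lemma primitive (v : R -> R) (a : R) : continuous v ->
  exists U : R -> R, forall t, a < t -> is_derive t 1 U (v t).
Proof.
move=> cv.
exists (fun x => \int[lebesgue_measure]_(t in `[a, x]) v t) => t at_.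
have [||d dE] := @continuous_FTC1_closed _ v a t (t + 1) _ _ at_ (cv t).
- by rewrite ltrDl.
- apply: continuous_compact_integrable; first exact: segment_compact.
  exact: continuous_subspaceT.
- by rewrite -dE derive1E; exact: derivableP.
Qed.

Lemma primitiveC (v : R -> R[i]) (a : R) : continuousC v ->
  exists U : R -> R[i], forall t, a < t -> is_deriveC U t (v t).
Proof.
move=> [/(primitive a)[U1 d1] /(primitive a)[U2 d2]].
by exists (fun x => U1 x +i* U2 x) => t at_; split => /=; [exact: d1|exact: d2].
Qed.

Lemma ge0_integral_haar (g : circle R -> \bar R) :
  measurable_fun setT g -> (forall z, 0 <= g z)%E ->
  (\int[haar]_z g z =
   ((2 * pi)^-1)%:E * \int[lebesgue_measure]_(t in `[0%R, (2 * pi)%R]) g (expi t))%E.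
Proof.
move=> mg g0; rewrite ge0_integral_distribution//.
rewrite integral_uniform ?subr0//.
- exact: (measurableT_comp mg (@measurable_expi R)).
- by move=> t; exact: g0.
Qed.

Lemma haar_integrable (g : circle R -> R) (M : R) :
  measurable_fun setT g -> (forall z, `|g z| <= M) ->
  (@haar R).-integrable setT (EFin \o g).
Proof.
move=> mg gM; apply: measurable_bounded_integrable => //.
  by rewrite [X in (X < _)%E]probability_setT ltry.
exists M; split; first exact: num_real.
by move=> x Mx z _ /=; apply: le_trans (gM z) (ltW Mx).
Qed.

(** The bound -1 stands for any negative number: it makes 0 an interior point, so that U is
    continuous at both ends of [0, 2 pi]. *)
Lemma haar_FTC (g : circle R -> R) (U : R -> R) :
  continuous (fun t => g (expi t)) ->
  (forall t : R, -1 < t -> is_derive t 1 U (g (expi t))) ->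
  \int[haar]_(z in setT) g z = (U (2 * pi) - U 0) / (2 * pi).
Proof.
move=> cg dU; have tp := twopi_gt0 R.
have [M gM] := continuous_bounded cg.
have {}gM z : `|g z| <= M by rewrite -(expi_carg z); apply: gM; exact: carg_itv.
have mg : measurable_fun setT g.
  have /measurable_complexP[] // : measurable_fun setT (fun z => (g z)%:C).
  by apply: measurable_circle_fun; exact: continuousC_real.
have ig := haar_integrable mg gM.
have iM : (@haar R).-integrable setT (EFin \o cst M).
  exact: (@haar_integrable (cst M) `|M|).
(* [ge0_integral_haar] wants a nonnegative integrand, so g is shifted by its bound M; the total mass
   1 makes the correction equal to M. *)
have -> : g = (fun z => (g z + M) - M) by apply/funext => z; rewrite addrK.
have igM : (@haar R).-integrable setT (EFin \o (fun z => g z + M)).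
  rewrite (_ : _ \o _ = (EFin \o g) \+ (EFin \o cst M))//.
  exact: integrableD.
rewrite RintegralB// Rintegral_cst// [X in fine X]probability_setT /= mulr1.
rewrite /Rintegral ge0_integral_haar; last 2 first.
- by apply/measurable_EFinP; exact: measurable_funD.
- by move=> z; rewrite lee_fin; have := gM z; rewrite ler_norml; lra.
have dV (t : R) : -1 < t -> is_derive t 1 (U + M \*: (@id R)) (g (expi t) + M).
  move=> t1; have dUt := dU t t1; apply: is_derive_eq.
  by rewrite /GRing.scale /= mulr1.
have cV (t : R) : -1 < t -> {for t, continuous (U + M \*: (@id R))}.
  move=> /dV dVt; apply: differentiable_continuous; apply/derivable1_diffP.
  exact: ex_derive.
rewrite (@continuous_FTC2 _ (fun t => g (expi t) + M) (U + M \*: (@id R)))//.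
- rewrite -EFinB -EFinM /= !fctE /= /GRing.scale/= mulr0 addr0.
  by move: (lt0r_neq0 tp); move: (2 * pi) => p p0; field.
- by apply: continuous_subspaceT => t; apply: cvgD; [exact: cg|exact: cvg_cst].
- split.
  + move=> t; rewrite in_itv/= => /andP[t0 _].
    by apply: (@ex_derive _ _ _ _ _ _ _ (dV t _)); lra.
  + by apply: cvg_at_right_filter; apply: cV; lra.
  + by apply: cvg_at_left_filter; apply: cV; lra.
- move=> t; rewrite in_itv/= => /andP[t0 _]; rewrite derive1E.
  by apply: (@derive_val _ _ _ _ _ _ _ (dV t _)); lra.
Qed.

Lemma cint_FTC g (U : R -> R[i]) :
  continuousC (fun t => g (expi t)) ->
  (forall t : R, -1 < t -> is_deriveC U t (g (expi t))) ->
  cint g = (U (2 * pi) - U 0) * ((2 * pi)^-1)%:C.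
Proof.
move=> [c1 c2] dU; rewrite /cint.
rewrite (haar_FTC c1 (fun t (t1 : -1 < t) => (dU t t1).1)).
rewrite (haar_FTC c2 (fun t (t1 : -1 < t) => (dU t t1).2)).
by apply/eqP; rewrite eq_complex ReM ImM /= !mulr0 subr0 add0r mulrC raddfB raddfB/=
  mulrC !eqxx.
Qed.

Lemma cintD g h :
  continuousC (fun t => g (expi t)) -> continuousC (fun t => h (expi t)) ->
  cint (fun z => g z + h z) = cint g + cint h.
Proof.
move=> cg ch.
have [U dU] := primitiveC (-1) cg; have [V dV] := primitiveC (-1) ch.
rewrite (cint_FTC cg dU) (cint_FTC ch dV).
rewrite (@cint_FTC _ (fun x => U x + V x)); first ring.
- exact: continuousCD.
- by move=> t t1; apply: is_deriveCD; [exact: dU|exact: dV].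
Qed.

Lemma cintZ g (c : R[i]) : continuousC (fun t => g (expi t)) ->
  cint (fun z => c * g z) = c * cint g.
Proof.
move=> cg; have [U dU] := primitiveC (-1) cg.
rewrite (cint_FTC cg dU) (@cint_FTC _ (fun x => c * U x)); first ring.
- exact: continuousCM (continuousC_cst c) cg.
- move=> t t1; have := is_deriveCM (is_deriveC_cst c t) (dU t t1).
  by rewrite mul0r add0r.
Qed.

(** A function on the circle has the same value at both ends of the period. Applied to a product,
    this is integration by parts without boundary terms. *)
Lemma cint_derive g g' :
  (forall t, is_deriveC (fun x => g (expi x)) t (g' (expi t))) ->
  continuousC (fun t => g' (expi t)) -> cint g' = 0.
Proof.
move=> dg cg'; rewrite (cint_FTC cg' (fun t _ => dg t)).
by rewrite -[2 * pi]add0r periodic_expi subrr mul0r.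
Qed.

Lemma is_deriveC_expi_exp (H : R -> R) (m : int) (t d : R) : is_derive t 1 H d ->
  is_deriveC (fun x => (expi (H x) : R[i]) ^ m) t
    ('i%C * m%:~R * d%:C * (expi (H t) : R[i]) ^ m).
Proof.
move=> dH; under eq_fun do rewrite expi_exp; rewrite expi_exp.
have dmH : is_derive t 1 (fun x => m%:~R * H x) (m%:~R * d).
  by apply: is_derive_eq.
have := is_deriveC_comp (is_deriveC_expi _) dmH.
rewrite rmorphM /= rmorph_int => h; congr (is_deriveC _ _ _) : h.
ring.
Qed.

Lemma continuousC_expi_exp (H : R -> R) (m : int) : continuous H ->
  continuousC (fun x => (expi (H x) : R[i]) ^ m).
Proof.
move=> cH; under eq_fun do rewrite expi_exp.
apply: continuousC_comp (continuousC_expi R) _ => t.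
by apply: cvgM; [exact: cvg_cst|exact: cH].
Qed.

(** For nonzero m, i m z^m is the angular derivative of z^m, so its mean vanishes. *)
Lemma cint_exp (m : int) : cint (fun z : circle R => (z : R[i]) ^ m) = (m == 0)%:R.
Proof.
have [->|m0] := eqVneq m 0.
  rewrite (@cint_FTC _ (fun x => x%:C)) => [|/=|t _].
  - by rewrite subr0 -rmorphM /= divff// gt_eqF// twopi_gt0.
  - exact: continuousC_cst.
  - by rewrite expr0z; apply: is_deriveC_real; exact: is_derive_id.
have cE := continuousC_expi_exp m (fun t : R => @cvg_id _ (nbhs t)).
have imE : 'i%C * m%:~R != 0 :> R[i].
  by rewrite mulf_neq0 ?intr_eq0// i_neq0.
apply: (mulfI imE); rewrite mulr0 -cintZ//.
apply: (@cint_derive (fun z => (z : R[i]) ^ m)).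
  move=> t; have := is_deriveC_expi_exp m (is_derive_id t 1).
  by rewrite mulr1.
exact: continuousCM (continuousC_cst _) cE.
Qed.

(** If P is a primitive of g(e^it), then P o H is a primitive of the left integrand, and its
    increment is that of P over [H 0, H 0 + 2 pi]. The increment of P over a full period does not
    depend on where the period starts. *)
Lemma cint_change (f : circle R -> circle R) (H : R -> R) (d : circle R -> R) g :
  (forall t, f (expi t) = expi (H t)) ->
  {homo H : x y / x < y} ->
  H (2 * pi) = H 0 + 2 * pi ->
  (forall t : R, is_derive t 1 H (d (expi t))) ->
  continuous (fun t => d (expi t)) ->
  continuousC (fun t => g (expi t)) ->
  cint (fun z => (d z)%:C * g (f z)) = cint g.
Proof.
move=> fH Hlt H2 dH cd cg; have tp := twopi_gt0 R.
(* P must be a primitive on a half-line containing both ]-1, +oo[ and its image under H. *)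
pose a := Num.min (-1) (H (-1)).
have [P dP] := primitiveC a cg.
have a1 : a <= -1 by rewrite ge_min lexx.
have aH t : -1 < t -> a < H t.
  by move=> /Hlt; apply: le_lt_trans; rewrite ge_min lexx orbT.
have cH : continuous H.
  move=> t; apply: differentiable_continuous; apply/derivable1_diffP.
  exact: (@ex_derive _ _ _ _ _ _ _ (dH t)).
rewrite (cint_FTC cg (fun t (t1 : -1 < t) => dP t (le_lt_trans a1 t1))).
rewrite (@cint_FTC _ (fun x => P (H x))); last 2 first.
- apply: continuousCM; first exact: continuousC_real.
  by under eq_fun do rewrite fH; exact: continuousC_comp cg cH.
- by move=> t t1; rewrite fH; exact: is_deriveC_comp (dP _ (aH t t1)) (dH t).
congr (_ * _).
(* By periodicity of the integrand, P (x + 2 pi) - P x has derivative 0. *)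
have PE x y : a < x -> a < y -> P (x + 2 * pi) - P x = P (y + 2 * pi) - P y.
  have dPP t : a < t -> is_deriveC (fun x => P (x + 2 * pi) + (- 1) * P x) t 0.
    move=> at_.
    have dt : is_derive t 1 (fun x : R => x + 2 * pi) 1.
      by apply: is_derive_eq; rewrite addr0.
    have h : a < t + 2 * pi by lra.
    have := is_deriveCD (@is_deriveC_comp _ P (fun x => x + 2 * pi) t _ 1 (dP _ h) dt)
      (is_deriveCM (is_deriveC_cst (-1) t) (dP _ at_)).
    rewrite periodic_expi mul1r mul0r add0r mulN1r.
    by rewrite subrr.
  move=> ax ay; apply/eqP; rewrite -(mulN1r (P x)) -(mulN1r (P y)) eq_complex.
  apply/andP; split; apply/eqP.
  - apply: (@derive0_cst (fun x => Re (P (x + 2 * pi) + -1 * P x)) a) => // t h.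
    exact: (dPP t h).1.
  - apply: (@derive0_cst (fun x => Im (P (x + 2 * pi) + -1 * P x)) a) => // t h.
    exact: (dPP t h).2.
rewrite H2 (PE (H 0) 0) ?add0r//; first by apply: aH; lra.
by lra.
Qed.

End CircleIntegral.

(** * Lifts of circle diffeomorphisms and their derivatives *)

Section Lifts.
Variable R : realType.
Import ComplexField.Normc complex.
Local Open Scope complex_scope.
Local Open Scope classical_set_scope.
Implicit Types (h k : circle R -> circle R) (H G : R -> R).

Lemma dthetaE (g : circle R -> R[i]) (t : R) (c : R[i]) :
  is_deriveC (fun x => g (expi x)) t c -> dtheta g (expi t) = c.
Proof.
move=> dg.
have dt : is_derive (0 : R) 1 (fun x : R => x + t) 1.
  by apply: is_derive_eq; rewrite addr0.
have h : is_deriveC (fun x => g (expi x)) (0 + t) c by rewrite add0r.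
have := @is_deriveC_comp _ (fun x => g (expi x)) (fun x => x + t) 0 _ 1 h dt.
rewrite mul1r => -[d1 d2].
have e : (fun x => g (cmul (expi t) (expi x))) = (fun x => g (expi (x + t))).
  by apply/funext => x; rewrite addrC expiD.
rewrite /dtheta e /Defs.derivC !derive1E.
rewrite (@derive_val _ _ _ _ _ _ _ d1) (@derive_val _ _ _ _ _ _ _ d2).
by case: c {dg h d1 d2}.
Qed.

(* [delta f n] is [speed (iterz f n)] up to conversion. *)
Definition speed h (z : circle R) : R :=
  Re ((z : R[i]) * dz (fun w => h w) z / (h z : R[i])).

(** The angular derivative of e^iH is i H' e^iH; the factor (i z)^-1 in D, the factor z and the
    division by h leave H'. *)
Lemma speedE h H (t d : R) :
  (forall t, h (expi t) = expi (H t)) -> is_derive t 1 H d ->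
  speed h (expi t) = d.
Proof.
move=> hH dH; rewrite /speed /dz (@dthetaE _ _ (d%:C * ('i%C * (h (expi t) : R[i])))).
  have h0 := circle_neq0 (h (expi t)); have e0 := circle_neq0 (expi t).
  rewrite (_ : _ * _ / _ = d%:C)//; field.
  by rewrite h0 e0 i_neq0.
under eq_fun do rewrite hH.
by rewrite hH; apply: (is_deriveC_comp (is_deriveC_expi _) dH).
Qed.

(** A package stable under composition, so that it passes to all iterates by induction. *)
Record diffeo_lift h H : Prop := DiffeoLift {
  lift_expi : forall t, h (expi t) = expi (H t) ;
  lift_homo : {homo H : x y / x < y} ;
  lift_period : forall t, H (t + 2 * pi) = H t + 2 * pi ;
  lift_derive : forall t : R, is_derive t 1 H (speed h (expi t)) ;
  speed_gt0 : forall z, 0 < speed h z ;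
  speed_C1 : exists2 d2 : R -> R,
    (forall t : R, is_derive t 1 (fun x => speed h (expi x)) (d2 t)) &
    continuous d2 }.

Lemma is_derive_continuous (u v : R -> R) :
  (forall t : R, is_derive t 1 u (v t)) -> continuous u.
Proof.
move=> du t; apply: differentiable_continuous; apply/derivable1_diffP.
exact: (@ex_derive _ _ _ _ _ _ _ (du t)).
Qed.

(** The chain rule for lifts; for iterates of [f] it is the cocycle identity of the densities
    [delta]. *)
Lemma speed_comp h k H G : diffeo_lift h H -> diffeo_lift k G ->
  forall z, speed (h \o k) z = speed h (k z) * speed k z.
Proof.
move=> lh lk z; rewrite -(expi_carg z) (lift_expi lk).
apply: (@speedE _ (H \o G)) => [t|].
  by rewrite /= (lift_expi lk) (lift_expi lh).
by apply: is_derive1_comp; [exact: lift_derive lh _|exact: lift_derive lk _].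
Qed.

Lemma diffeo_lift_id : diffeo_lift id id.
Proof.
have s1 z : speed id z = 1.
  by rewrite -(expi_carg z); apply: (@speedE _ id).
split=> //.
- by move=> t; rewrite s1; exact: is_derive_id.
- by move=> z; rewrite s1.
- exists (fun=> 0) => [t|]; last exact: cst_continuous.
  rewrite (_ : (fun x => _) = cst 1); first exact: is_derive_cst.
  by apply/funext => x; rewrite s1.
Qed.

Lemma diffeo_lift_comp h k H G :
  diffeo_lift h H -> diffeo_lift k G -> diffeo_lift (h \o k) (H \o G).
Proof.
move=> lh lk; have sE := speed_comp lh lk.
split.
- by move=> t; rewrite /= (lift_expi lk) (lift_expi lh).
- by move=> x y xy; apply: (lift_homo lh); exact: (lift_homo lk).
- by move=> t; rewrite /= (lift_period lk) (lift_period lh).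
- move=> t; rewrite sE (lift_expi lk).
  by apply: is_derive1_comp; [exact: lift_derive lh _|exact: lift_derive lk _].
- move=> z; rewrite sE; apply: mulr_gt0; first exact: speed_gt0 lh _.
  exact: speed_gt0 lk _.
have [h2 dh2 ch2] := speed_C1 lh; have [k2 dk2 ck2] := speed_C1 lk.
have cG := is_derive_continuous (lift_derive lk).
have csh := is_derive_continuous dh2; have csk := is_derive_continuous dk2.
exists (fun t => speed h (expi (G t)) * k2 t +
  speed k (expi t) * (h2 (G t) * speed k (expi t))).
- move=> t; rewrite (_ : (fun x => _) =
    ((fun x => speed h (expi x)) \o G) * (fun x => speed k (expi x))).
    have d1 := @is_derive1_comp _ _ _ t _ _ (dh2 (G t)) (lift_derive lk t).
    have d2 := dk2 t.
    exact: is_deriveM.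
  by apply/funext => x; rewrite sE (lift_expi lk).
- move=> t.
  have chG := continuous_comp (cG t) (csh (G t)).
  have ch2G := continuous_comp (cG t) (ch2 (G t)).
  apply: cvgD; apply: cvgM => //; first exact: ck2.
    exact: csk.
  by apply: cvgM => //; exact: csk.
Qed.

(** By continuity H x stays within pi/2 of H t for x near t, where H x = H t + asin (sin (H x - H
    t)). The inner sine is a linear combination of cos H and sin H with constant coefficients, hence
    differentiable. *)
Lemma is_derive_angle H (t c' s' : R) : {for t, continuous H} ->
  is_derive t 1 (fun x => cos (H x)) c' -> is_derive t 1 (fun x => sin (H x)) s' ->
  is_derive t 1 H (s' * cos (H t) - c' * sin (H t)).
Proof.
move=> cH dc ds; pose a := H t.
pose S (x : R) := sin (H x - a).
have St : S t = 0 by rewrite /S subrr sin0.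
have dS : is_derive t 1 S (s' * cos a - c' * sin a).
  rewrite (_ : S = cos a *: (fun x => sin (H x)) - sin a *: (fun x => cos (H x))).
    by apply: is_derive_eq; rewrite /GRing.scale /=; ring.
  by apply/funext => x; rewrite /S sinB mulrC [X in _ - X]mulrC.
have das : is_derive (S t) 1 (@asin R) 1.
  rewrite St; have := @is_derive1_asin R 0 _.
  by rewrite expr0n subr0 sqrtr1 invr1; apply; lra.
have d2 : is_derive t 1 (fun x => a + asin (S x)) (s' * cos a - c' * sin a).
  have d3 := @is_derive1_comp _ _ _ t _ _ das dS.
  rewrite (_ : (fun x => _) = cst a + (@asin R) \o S)//.
  by apply: is_derive_eq; rewrite add0r mul1r.
apply: near_eq_is_derive d2.
have := pi_gt0 R => pp.
have : \forall x \near t, `|H t - H x| < pi / 2.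
  by move/cvgr_dist_lt : cH; apply; rewrite divr_gt0.
apply: filterS => x; rewrite ltr_norml => hx.
rewrite /S sinK ?in_itv/=; last by rewrite /a; lra.
by rewrite addrC subrK.
Qed.

(** The two values have the same image on the circle, so they differ by a multiple of 2 pi, positive
    because H increases. *)
Lemma lift_step h H : (forall t, h (expi t) = expi (H t)) ->
  {homo H : x y / x < y} ->
  forall t, exists n : nat, H (t + 2 * pi) = H t + 2 * pi * n.+1%:R.
Proof.
move=> hH Hlt t; have tp := twopi_gt0 R.
have [|n nE] := @expi_eq _ (H (t + 2 * pi)) (H t).
  by rewrite -!hH periodic_expi.
have : H t < H (t + 2 * pi) by apply: Hlt; rewrite ltrDl.
rewrite {1}nE ltrDl pmulr_rgt0// ltr0z.
by case: n nE => [[|n]|n] // nE _; exists n; exact: nE.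
Qed.

(** H gains at least 2 pi over each period, so it is unbounded in both directions and the
    intermediate value theorem applies. *)
Lemma lift_surj h H : (forall t, h (expi t) = expi (H t)) ->
  {homo H : x y / x < y} -> continuous H -> forall y, exists x, H x = y.
Proof.
move=> hH Hlt cH y; have tp := twopi_gt0 R.
have step t : H t + 2 * pi <= H (t + 2 * pi).
  have [n ->] := lift_step hH Hlt t.
  by rewrite lerD2l ler_peMr ?(ltW tp)// ler1n.
have up n : H 0 + 2 * pi * n%:R <= H (2 * pi * n%:R).
  elim: n => [|n IH]; first by rewrite mulr0 addr0.
  rewrite -[n.+1%:R]natr1 mulrDr mulr1 addrA; apply: le_trans (step _).
  by rewrite lerD2r.
have dn n : H (- (2 * pi * n%:R)) <= H 0 - 2 * pi * n%:R.
  elim: n => [|n IH]; first by rewrite mulr0 oppr0 addr0.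
  have := step (- (2 * pi * n.+1%:R)).
  rewrite (_ : - _ + 2 * pi = - (2 * pi * n%:R)); last by rewrite -[n.+1%:R]natr1; ring.
  by move=> /le_trans/(_ IH); rewrite -[n.+1%:R]natr1; lra.
have [n nE] : exists n : nat, `|y - H 0| <= 2 * pi * n%:R.
  exists (Num.truncn (`|y - H 0| / (2 * pi))).+1.
  rewrite mulrC -ler_pdivrMr//; apply: ltW; apply: truncnS_gt.
have n0 : 0 <= 2 * pi * n%:R :> R by rewrite mulr_ge0// ltW.
have [||| x _ <-] := @IVT _ H (- (2 * pi * n%:R)) (2 * pi * n%:R) y.
- lra.
- exact: continuous_subspaceT.
- move: nE (up n) (dn n); rewrite ler_norml ge_min le_max => /andP[y1 y2] u d.
  by apply/andP; split; apply/orP; [left|right]; lra.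
by exists x.
Qed.

(** Were the degree at least 2, some x strictly between t and t + 2 pi would satisfy H x = H t + 2
    pi, and h would take the same value at e^ix and e^it. *)
Lemma lift_degree1 h H : injective h -> (forall t, h (expi t) = expi (H t)) ->
  {homo H : x y / x < y} -> continuous H ->
  forall t, H (t + 2 * pi) = H t + 2 * pi.
Proof.
move=> hinj hH Hlt cH t; have tp := twopi_gt0 R.
have [[->|n nE]] := lift_step hH Hlt t; first by rewrite mulr1.
have Hle := le_mono Hlt.
have [x xE] := lift_surj hH Hlt cH (H t + 2 * pi).
have tx : t < x by rewrite -(leW_mono Hle) xE ltrDl.
have xt : x < t + 2 * pi.
  by rewrite -(leW_mono Hle) xE nE ltrD2l ltr_pMr// ltr1n.
have : expi x = expi t.
  by apply: hinj; rewrite !hH xE periodic_expi.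
move=> /expi_eq[m mE]; move: tx xt; rewrite mE ltrDl ltrD2l.
rewrite pmulr_rgt0// gtr_pMr// ltr0z ltrz1.
by case: m {mE} => // -[].
Qed.

(** K is the inverse of the increasing bijection H. Its continuity comes from order alone: a
    neighbourhood of y lies between H (K y - e) and H (K y + e). *)
Lemma lift_inverse h k H : cancel h k -> cancel k h ->
  (forall t, h (expi t) = expi (H t)) ->
  {homo H : x y / x < y} -> continuous H ->
  exists K : R -> R, [/\ forall t, k (expi t) = expi (K t),
    {homo K : x y / x < y}, continuous K & cancel K H].
Proof.
move=> hk kh hH Hlt cH; have [K HK] := choice (lift_surj hH Hlt cH).
have Hle := le_mono Hlt; have Hm := leW_mono Hle.
exists K; split=> //.
- by move=> t; apply: (can_inj hk); rewrite kh hH HK.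
- by move=> x y; rewrite -{1}(HK x) -{1}(HK y) Hm.
- move=> y; apply/cvgrPdist_lt => e e0.
  have l : H (K y - e) < y by rewrite -[ltRHS]HK Hm ltrBlDr ltrDl.
  have u : y < H (K y + e) by rewrite -[ltLHS]HK Hm ltrDl.
  near=> x.
  have lx : H (K y - e) < x by near: x; exact: lt_nbhsr l.
  have ux : x < H (K y + e) by near: x; exact: lt_nbhsl u.
  rewrite -[x in _ < x]HK Hm in lx; rewrite -[x in x < _]HK Hm in ux.
  by rewrite ltr_norml; lra.
Unshelve. all: by end_near.
Qed.

(** Smoothness of h speaks of c = cos H and s = sin H only, but H' = s' c - c' s. The products of
    first derivatives cancel in H'' = s'' c - c'' s. *)
Lemma lift_C2 h H : smooth (fun z => h z) ->
  (forall t, h (expi t) = expi (H t)) -> continuous H ->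
  (forall t : R, is_derive t 1 H (speed h (expi t))) /\
  exists2 d2 : R -> R,
    (forall t : R, is_derive t 1 (fun x => speed h (expi x)) (d2 t)) &
    continuous d2.
Proof.
move=> sm hH cH.
have C2 (u : R -> R) : (forall n (t : R), derivable (derive1n n u) t 1) ->
    exists u1 u2 : R -> R, [/\ forall t : R, is_derive t 1 u (u1 t),
      forall t : R, is_derive t 1 u1 (u2 t) & continuous u2].
  move=> du; exists (derive1n 1 u), (derive1n 2 u); split=> t.
  - by rewrite /= derive1E; apply: derivableP; exact: du 0%N t.
  - by rewrite [derive1n 2 u]/= derive1E; apply: derivableP; exact: du 1%N t.
  - by apply: differentiable_continuous; apply/derivable1_diffP; exact: du 2%N t.
pose c (x : R) := Re (h (expi x) : R[i]); pose s (x : R) := Im (h (expi x) : R[i]).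
have cE : c = fun x => cos (H x) by apply/funext => x; rewrite /c hH.
have sE : s = fun x => sin (H x) by apply/funext => x; rewrite /s hH.
have [c1 [c2 [dc dc1 cc2]]] := C2 c (fun n t => (sm n t).1).
have [s1 [s2 [ds ds1 cs2]]] := C2 s (fun n t => (sm n t).2).
have cc := is_derive_continuous dc; have cs := is_derive_continuous ds.
pose d (x : R) := s1 x * c x - c1 x * s x.
have dH (t : R) : is_derive t 1 H (d t).
  rewrite /d cE sE; apply: is_derive_angle; first exact: cH.
  - by rewrite -cE.
  - by rewrite -sE.
have speedd t : speed h (expi t) = d t by exact: (speedE hH (dH t)).
split; first by move=> t; rewrite speedd.
clear cE sE dH.
move: c s c1 s1 c2 s2 dc ds dc1 ds1 cc2 cs2 cc cs @d speedd.
move=> c s c1 s1 c2 s2 dc ds dc1 ds1 cc2 cs2 cc cs d speedd.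
exists (fun x => s2 x * c x - c2 x * s x).
- move=> t; rewrite (_ : (fun x => _) = s1 * c - c1 * s); last first.
    by apply/funext => x; rewrite speedd.
  have dd := is_deriveB (is_deriveM (ds1 t) (dc t)) (is_deriveM (dc1 t) (ds t)).
  by apply: is_derive_eq dd _; rewrite /GRing.scale /=; ring.
- move=> t; apply: cvgB; apply: cvgM.
  + exact: cs2.
  + exact: cc.
  + exact: cc2.
  + exact: cs.
Qed.

(** Monotonicity yields only nonnegative speeds. Differentiating H o K = id shows that the speeds of
    [f] and of its inverse have product 1 at corresponding points, so neither vanishes. *)
Lemma diffeo_lift_exists (f : circle_diffeo R) : orientation_preserving f ->
  (exists H, diffeo_lift f H) /\ (exists G, diffeo_lift (Defs.dinv f) G).
Proof.
move=> [F [cF fF] Flt]; have tp := twopi_gt0 R.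
(* Passage from lifts over R/Z to lifts in the angle. *)
pose H (x : R) := 2 * pi * F (x / (2 * pi)).
have fH t : f (expi t) = expi (H t).
  by rewrite /H -fF; congr (f (expi _)); rewrite mulrC divfK// gt_eqF.
have Hlt : {homo H : x y / x < y}.
  by move=> x y xy; rewrite /H ltr_pM2l//; apply: Flt; rewrite ltr_pM2r// invr_gt0.
have cH : continuous H.
  move=> t; apply: cvgM; first exact: cvg_cst.
  have cd : {for t, continuous (fun x : R => x / (2 * pi))}.
    by apply: cvgM; [exact: cvg_id|exact: cvg_cst].
  exact: (continuous_comp cd (cF _)).
have [K [kK Klt cK HK]] := lift_inverse (@dfunK _ f) (@dinvK _ f) fH Hlt cH.
have [dH C1H] := lift_C2 (@dfun_smooth _ f) fH cH.
have [dK C1K] := lift_C2 (@dinv_smooth _ f) kK cK.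
have ge0 (h : circle R -> circle R) (L : R -> R) : {homo L : x y / x < y} ->
    (forall t : R, is_derive t 1 L (speed h (expi t))) -> forall z, 0 <= speed h z.
  move=> Llt dL z; rewrite -(expi_carg z).
  rewrite -(@derive_val _ _ _ _ _ _ _ (dL (carg z))) -derive1E.
  apply: (@incr_derive1_ge0_itvy _ L true (carg z - 1)).
  - by move=> x _; exact: (@ex_derive _ _ _ _ _ _ _ (dL x)).
  - by move=> x y _ _; exact: Llt.
  - by rewrite in_itv/= andbT ltrBlDr ltrDl.
have inv1 t : speed f (expi (K t)) * speed (Defs.dinv f) (expi t) = 1.
  have := @is_derive1_comp _ H K t _ _ (dH (K t)) (dK t).
  rewrite (_ : H \o K = id); last exact/funext.
  move=> d1; rewrite -(@derive_val _ _ _ _ _ _ _ d1).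
  exact: (@derive_val _ _ _ _ _ _ _ (is_derive_id t 1)).
have HKc : cancel H K.
  by move=> x; apply: (inc_inj (le_mono Hlt)); rewrite HK.
split.
- exists H; split=> //; first exact: (lift_degree1 (can_inj (@dfunK _ f)) fH Hlt cH).
  move=> z; rewrite lt_neqAle (ge0 _ _ Hlt dH) andbT eq_sym.
  have := inv1 (H (carg z)); rewrite HKc expi_carg => e.
  by apply: contra_eq_neq e => ->; rewrite mul0r eq_sym oner_neq0.
- exists K; split=> //; first exact: (lift_degree1 (can_inj (@dinvK _ f)) kK Klt cK).
  move=> z; rewrite lt_neqAle (ge0 _ _ Klt dK) andbT eq_sym.
  have := inv1 (carg z); rewrite expi_carg => e.
  by apply: contra_eq_neq e => ->; rewrite mulr0 eq_sym oner_neq0.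
Qed.

Lemma diffeo_lift_iterz (f : circle_diffeo R) (n : int) :
  orientation_preserving f -> exists H, diffeo_lift (iterz f n) H.
Proof.
move=> /diffeo_lift_exists[[H lH] [G lG]].
have it (h : circle R -> circle R) (L : R -> R) m : diffeo_lift h L ->
    exists H, diffeo_lift (iter m h) H.
  move=> lL; elim: m => [|m [K lK]]; first by exists id; exact: diffeo_lift_id.
  by exists (L \o K); exact: (diffeo_lift_comp lL lK).
by case: n => n; [exact: it lH|exact: it lG].
Qed.

Lemma iterzK (f : circle_diffeo R) (n : int) :
  cancel (iterz f n) (iterz f (- n)).
Proof.
have it (h k : circle R -> circle R) m : cancel h k ->
    cancel (iter m h) (iter m k).
  move=> hk; elim: m => [//|m IH] z.
  by rewrite iterSr iterS hk IH.
by case: n => [[|n]|n] => //; apply: it; [exact: dfunK|exact: dinvK].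
Qed.

(** The cocycle identity for f^-n o f^n = id. *)
Lemma speed_iterzN (f : circle_diffeo R) (n : int) (z : circle R) :
  orientation_preserving f -> delta f (- n) (iterz f n z) * delta f n z = 1.
Proof.
move=> fo; have [H lH] := diffeo_lift_iterz n fo.
have [G lG] := diffeo_lift_iterz (- n) fo.
have := speed_comp lG lH z.
rewrite (_ : _ \o _ = id); last by apply/funext => w /=; rewrite iterzK.
move=> <-; rewrite -(expi_carg z).
by apply: (@speedE _ id).
Qed.

End Lifts.

(** * Diffeomorphisms pull null sets back to null sets *)

Section NullSets.
Variable R : realType.
Import ComplexField.Normc complex.
Local Open Scope complex_scope.
Local Open Scope classical_set_scope.
Notation lambda := (@lebesgue_measure R).

(* The preimage of a cover by intervals is a cover by intervals at most 1/c times
   as long. *)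
Lemma negligible_expansive_preimage (L K : R -> R) (c : R) (N : set R) :
  0 < c -> cancel K L -> (forall x y, x < y -> c * (y - x) <= L y - L x) ->
  lambda.-negligible N -> lambda.-negligible (L @^-1` N).
Proof.
move=> c0 KL Lc /negligible_outer_measure N0; apply/negligible_outer_measure.
have Lle x y : x <= y -> L x <= L y.
  rewrite le_eqVlt => /predU1P[->//|xy]; rewrite -subr_ge0.
  by apply: le_trans (Lc _ _ xy); apply: mulr_ge0; rewrite ?subr_ge0 ltW.
have Llt x y : x < y -> L x < L y.
  move=> xy; rewrite -subr_gt0; apply: lt_le_trans (Lc _ _ xy).
  by rewrite mulr_gt0// subr_gt0.
have Klt x y : (K x < K y) = (x < y).
  apply/idP/idP => [xy|].
    rewrite -(KL x) -(KL y) -subr_gt0; apply: lt_le_trans (Lc _ _ xy).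
    by rewrite mulr_gt0// subr_gt0.
  by apply: contraTT; rewrite -!leNgt => /Lle; rewrite !KL.
apply/eqP; rewrite eq_le outer_measure_ge0 andbT; apply/lee_addgt0Pr => e e0.
rewrite add0e.
have : (mu_ext (wlength idfun) N < (c * e)%:E)%E.
  by rewrite N0 lte_fin mulr_gt0.
move=> /ereal_inf_lt[_ [F [mF FN] <-] Fe].
have /choice[ab abE] k : exists ab : R * R, F k = `]ab.1, ab.2]%classic.
  by have [[a b] _ <-] := mF k; exists (a, b).
pose G k : set R := `]K (ab k).1, K (ab k).2]%classic.
apply: (@le_trans _ _ (\sum_(0 <= k <oo) wlength idfun (G k))%E).
  apply: ereal_inf_lbound; exists G => //; split.
    by move=> k; exists (K (ab k).1, K (ab k).2).
  move=> x /FN[k _]; rewrite abE /= in_itv/= => /andP[x1 x2].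
  exists k => //; rewrite /G /= in_itv/=; apply/andP; split.
    by rewrite ltNge; apply/negP => /Lle; rewrite KL leNgt x1.
  by rewrite leNgt; apply/negP => /Llt; rewrite KL ltNge x2.
apply: (@le_trans _ _ (\sum_(0 <= k <oo) (c^-1)%:E * wlength idfun (F k))%E).
  apply: lee_nneseries => [k _ _|k _]; first exact: wlength_ge0.
  rewrite abE /G !wlength_itv /= !lte_fin Klt.
  case: ifPn => [abk|_]; last by rewrite mule0.
  rewrite -!EFinB -EFinM lee_fin ler_pdivlMl//.
  by have := Lc (K (ab k).1) (K (ab k).2); rewrite Klt !KL => /(_ abk).
rewrite nneseriesZl; last by move=> k _; exact: wlength_ge0.
by rewrite lee_pdivrMl// ltW.
Qed.

Lemma haarE (A : set (circle R)) : measurable A ->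
  (haar A = ((2 * pi)^-1)%:E *
    lambda (expi (R := R) @^-1` A `&` `[0%R, (2 * pi)%R]))%E.
Proof.
move=> mA; have := @integral_indic _ _ R (@haar R) setT measurableT A mA.
rewrite setIT => <-; rewrite ge0_integral_haar.
- congr (_ * _)%E; rewrite -integral_indic//.
  by rewrite -[X in measurable X]setTI; exact: (@measurable_expi R).
- by apply/measurable_EFinP; exact: measurable_indic.
- by move=> z; rewrite lee_fin.
Qed.

Lemma haar_negligible (B : set (circle R)) : haar.-negligible B ->
  lambda.-negligible (expi (R := R) @^-1` B `&` `[0, 2 * pi]).
Proof.
have tp := twopi_gt0 R.
move=> [A [mA A0 BA]]; exists (expi (R := R) @^-1` A `&` `[0, 2 * pi]); split.
- apply: measurableI; last exact: measurable_itv.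
  by rewrite -[X in measurable X]setTI; exact: (@measurable_expi R).
- move: A0; rewrite haarE// => /eqP; rewrite mule_eq0 => /orP[|/eqP//].
  by rewrite eqe invr_eq0 gt_eqF.
- by move=> t [/BA Bt ?]; split.
Qed.

Lemma measurable_diffeo h H : diffeo_lift h H -> measurable_fun [set: circle R] h.
Proof.
move=> lh; have cH := is_derive_continuous (lift_derive lh).
have mh : measurable_fun setT (fun z => h z : R[i]).
  apply: measurable_circle_fun; under eq_fun do rewrite (lift_expi lh).
  exact: continuousC_comp (@continuousC_expi R) cH.
move=> _ _ [M mM <-]; rewrite (setTI (@circle_val R @^-1` M)).
exact: mh measurableT M mM.
Qed.

(** Compactness of one period; c serves as the expansion constant of the lift. *)
Lemma speed_lower_bound h H : diffeo_lift h H ->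
  exists2 c : R, 0 < c & forall z, c <= speed h z.
Proof.
move=> lh; have [d2 dd2 _] := speed_C1 lh.
have pp := pi_gt0 R.
have [||x _ xm] := @EVT_min _ (fun x => speed h (expi x)) (- pi) pi.
- lra.
- exact: continuous_subspaceT (is_derive_continuous dd2).
exists (speed h (expi x)); first exact: speed_gt0 lh _.
move=> z; rewrite -[in leRHS](expi_carg z); apply: xm.
by rewrite in_itv /= carg_itv.
Qed.

(** Null sets of the circle are seen on [0, 2 pi], which H does not preserve. For each t some
    translate H t - 2 pi n falls back into it, so the preimage is covered by countably many
    preimages under expansive maps. *)
Lemma ae_haar_diffeo h H (P : circle R -> Prop) : diffeo_lift h H ->
  (\forall z \ae haar, P z) -> \forall z \ae haar, P (h z).
Proof.
move=> lh [B [mB B0 PB]]; have tp := twopi_gt0 R.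
have mhB : measurable (h @^-1` B).
  by rewrite -[X in measurable X]setTI; exact: measurable_diffeo lh _ _ mB.
exists (h @^-1` B); split => //; last by move=> z /= Pz; exact: PB.
have nB : lambda.-negligible (expi (R := R) @^-1` B `&` `[0, 2 * pi]).
  by apply: haar_negligible; exists B; split.
set N := _ `&` _ in nB.
have cH := is_derive_continuous (lift_derive lh).
have [K HK] := choice (lift_surj (lift_expi lh) (lift_homo lh) cH).
have [c c0 cs] := speed_lower_bound lh.
have Hc (x y : R) : x < y -> c * (y - x) <= H y - H x.
  move=> xy; have [t _||t _ ->] := @MVT _ H (fun t => speed h (expi t)) x y xy.
  - exact: lift_derive lh t.
  - exact: continuous_subspaceT.
  - by apply: ler_wpM2r (cs _); rewrite subr_ge0 ltW.
(* An enumeration of the integers; the default 0 on non-codes only repeats one of the null sets. *)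
pose z (i : nat) : int := odflt 0 (unpickle i).
pose L i (x : R) : R := H x - 2 * pi * (z i)%:~R.
have nL i : lambda.-negligible (L i @^-1` N).
  apply: (@negligible_expansive_preimage _ (fun y => K (y + 2 * pi * (z i)%:~R)) c) => //.
  - by move=> y; rewrite /L HK addrK.
  - by move=> x y /Hc; rewrite /L; lra.
have nU : lambda.-negligible (\bigcup_i (L i @^-1` N)).
  exact: negligible_bigcup.
rewrite haarE//; apply/eqP; rewrite mule_eq0; apply/orP; right; apply/eqP.
apply: measure_negligible.
  apply: measurableI; last exact: measurable_itv.
  by rewrite -[X in measurable X]setTI; exact: (@measurable_expi R).
apply: negligibleS nU => t [/= hB _].
pose n := Num.floor (H t / (2 * pi)).
have /andP[n1 n2] := floor_itv (H t / (2 * pi)); rewrite -/n in n1 n2.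
have u0 : 0 <= H t - 2 * pi * n%:~R by rewrite subr_ge0 mulrC -ler_pdivlMr.
have u2 : H t - 2 * pi * n%:~R <= 2 * pi.
  rewrite lerBlDr -[X in X + _]mulr1 -mulrDr mulrC -ler_pdivrMr//.
  by rewrite addrC -intrD1 ltW.
exists (pickle n) => //; rewrite /L /z pickleK /=; split.
- change (B (expi (H t - 2 * pi * n%:~R))).
  by rewrite -mulrN -mulrNz expiD2pi -(lift_expi lh).
- by rewrite /= in_itv/= u0.
Qed.

End NullSets.

(** * Uniqueness of the absolutely continuous representative *)

Section AbsolutelyContinuous.
Variable R : realType.
Import ComplexField.Normc complex.
Local Open Scope complex_scope.
Local Open Scope classical_set_scope.
Notation lambda := (@lebesgue_measure R).

(** Absolute continuity tested on the single interval between s and t. *)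
Lemma abs_cont_near (a b : R) (u : R -> R[i]) (s e : R) : abs_cont a b u ->
  a <= s <= b -> 0 < e -> exists2 d : R, 0 < d &
  forall t, a <= t <= b -> `|t - s| < d -> normc (u t - u s) < e.
Proof.
move=> ac sI e0; have [d d0 dP] := ac e e0; exists d => // t tI ts.
have normcB (x y : R[i]) : normc (x - y) = normc (y - x).
  by case: x y => x1 x2 [y1 y2] /=; congr Num.sqrt; ring.
have triv (F : 'I_1 -> set R) : trivIset setT F.
  by move=> i j _ _ _; rewrite (ord1 i) (ord1 j).
have [st|st] := leP s t.
- have := dP 1%N (fun=> s) (fun=> t); rewrite !big_ord1; apply => //.
  + by move=> _; split => //; lra.
  + by move: ts; rewrite ger0_norm// subr_ge0.
- rewrite normcB; have := dP 1%N (fun=> t) (fun=> s); rewrite !big_ord1; apply => //.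
  + by move=> _; split; lra.
  + by move: ts; rewrite distrC ger0_norm// subr_ge0 ltW.
Qed.

(** Two functions that differ at t differ, by continuity, on a whole interval, which has positive
    measure. *)
Lemma AC_ae_eq (g1 g2 : circle R -> R[i]) :
  Defs.AC g1 -> Defs.AC g2 -> g1 = g2 %[ae haar] -> g1 = g2.
Proof.
move=> ac1 ac2 g12; have tp := twopi_gt0 R; have pp := pi_gt0 R.
suff H t : 0 <= t <= 2 * pi -> g1 (expi t) = g2 (expi t).
  apply/funext => z; rewrite -(expi_carg z); have := carg_itv z.
  have [z0 zI|z0 zI] := leP 0 (carg z); first by apply: H; lra.
  by rewrite -periodic_expi; apply: H; lra.
move=> tI; apply/eqP; rewrite -subr_eq0; apply/negPn/negP => ne.
pose e := normc (g1 (expi t) - g2 (expi t)).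
have e0 : 0 < e.
  rewrite lt_neqAle; apply/andP; split; last first.
    by rewrite /e; case: (_ - _) => ? ?; exact: sqrtr_ge0.
  by rewrite eq_sym; apply: contra ne => /eqP/eq0_normc ->.
have [d1 d10 h1] := abs_cont_near ac1 tI (divr_gt0 e0 (ltr0n _ 2)).
have [d2 d20 h2] := abs_cont_near ac2 tI (divr_gt0 e0 (ltr0n _ 2)).
pose d := Num.min d1 d2; have d0 : 0 < d by rewrite lt_min d10.
(* Trimmed to [0, 2 pi]: at an endpoint the interval becomes one-sided but stays nondegenerate. *)
pose l := Num.max 0 (t - d); pose r := Num.min (2 * pi) (t + d).
have lr : l < r by rewrite gt_max !lt_min; apply/andP; split; apply/andP; split; lra.
have nJ : lambda.-negligible (`]l, r[%classic : set R).
  apply: negligibleS (haar_negligible g12) => s /=.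
  rewrite in_itv/= gt_max lt_min => /andP[/andP[s1 s2] /andP[s3 s4]].
  split; last by rewrite /= in_itv/= !ltW.
  move=> /(_ Logic.I) gE.
  have sI : 0 <= s <= 2 * pi by rewrite !ltW.
  have sd : `|s - t| < d by rewrite ltr_norml; lra.
  have := h1 s sI; have := h2 s sI; move: sd; rewrite lt_min => /andP[sd1 sd2].
  move=> /(_ sd2) k2 /(_ sd1) k1; move: k1 k2; rewrite gE => k1 k2.
  have : e < e / 2 + e / 2.
    rewrite {1}/e (_ : _ - _ = (g2 (expi s) - g2 (expi t)) -
      (g2 (expi s) - g1 (expi t))); last ring.
    by apply: (le_lt_trans (le_normcD _ _)); rewrite normcN; exact: ltrD.
  by rewrite -splitr ltxx.
have : lambda (`]l, r[%classic : set R) = 0%E.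
  by apply: measure_negligible => //; exact: measurable_itv.
rewrite lebesgue_measure_itv /= lte_fin lr => /eqP.
by rewrite -EFinB eqe subr_eq0 gt_eqF.
Qed.

End AbsolutelyContinuous.

(** * Vectors with a single nonzero component, and their inner products *)

Section HilbertSpace.
Variable R : realType.
Import ComplexField.Normc complex.
Local Open Scope complex_scope.
Local Open Scope classical_set_scope.
Implicit Types (g phi psi : circle R -> R[i]).

Definition circle_cont g := continuousC (fun t => g (expi t)).

(** Here g' is the angular derivative i z D g, the one that enters L. *)
Definition circle_C1 g g' :=
  (forall t, is_deriveC (fun x => g (expi x)) t (g' (expi t))) /\ circle_cont g'.

Lemma circle_C1_cont g g' : circle_C1 g g' -> circle_cont g.
Proof. by move=> [dg _]; exact: (is_deriveC_continuous dg). Qed.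

Lemma dz_C1 g g' : circle_C1 g g' ->
  forall z : circle R, 'i%C * (z : R[i]) * dz g z = g' z.
Proof.
move=> [dg _] z; rewrite /dz mulrA divff ?mul1r.
  by rewrite -[in LHS](expi_carg z) (dthetaE (dg _)) expi_carg.
by rewrite mulf_neq0 ?i_neq0 ?circle_neq0.
Qed.

(** A bound M on g' makes the real and imaginary parts M-Lipschitz by the mean value theorem. *)
Lemma AC_C1 g g' : circle_C1 g g' -> Defs.AC g.
Proof.
move=> [dg cg'] e e0.
have [M M0 gM] := circle_fun_bounded cg'.
(* The two parts cost M each; the added 1 keeps the denominator positive when M = 0. *)
exists (e / (2 * M + 1)); first by rewrite divr_gt0//; lra.
move=> n x y xyI _ xyd.
have mvt (u v : R -> R) (a b : R) : a <= b -> (forall t : R, is_derive t 1 u (v t)) ->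
    (forall t, `|v t| <= M) -> `|u b - u a| <= M * (b - a).
  rewrite le_eqVlt => /predU1P[->|ab] du vM; first by rewrite !subrr normr0 mulr0.
  have [|t _ ->] := @MVT _ u v a b ab.
    exact: continuous_subspaceT (is_derive_continuous du).
  have ab0 : 0 <= b - a by rewrite subr_ge0 ltW.
  by rewrite normrM (ger0_norm ab0); apply: ler_wpM2r.
have lip i : normc (g (expi (y i)) - g (expi (x i))) <= 2 * M * (y i - x i).
  have [_ xy _] := xyI i; apply: le_trans (normc_le_ReIm _) _.
  rewrite !raddfB /= mulrDl mul1r mulrDl; apply: lerD.
  - apply: (mvt _ _ _ _ xy (fun t => (dg t).1)) => t.
    exact: le_trans (ReIm_le_normc _).1 (gM _).
  - apply: (mvt _ _ _ _ xy (fun t => (dg t).2)) => t.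
    exact: le_trans (ReIm_le_normc _).2 (gM _).
apply: (@le_lt_trans _ _ (2 * M * \sum_(i < n) (y i - x i))).
  by rewrite mulr_sumr; apply: ler_sum => i _; exact: lip.
have M1 : 0 < 2 * M + 1 by lra.
apply: (@le_lt_trans _ _ ((2 * M + 1) * \sum_(i < n) (y i - x i))).
  apply: ler_wpM2r; last by rewrite lerDl.
  by apply: sumr_ge0 => i _; rewrite subr_ge0; case: (xyI i).
by rewrite mulrC -ltr_pdivlMr.
Qed.

Lemma sqnorm_lty phi : circle_cont phi -> (sqnorm phi < +oo)%E.
Proof.
move=> cphi; have [M M0 pM] := circle_fun_bounded cphi.
have mphi := measurable_circle_fun cphi.
apply: (@le_lt_trans _ _ (\int[haar]_(z in [set: circle R]) (M ^+ 2)%:E)%E).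
  apply: ge0_le_integral => //.
  - by move=> z _; rewrite lee_fin sqr_ge0.
  - apply/measurable_EFinP; apply: measurable_funX.
    exact: (measurableT_comp (@measurable_normc R)).
  - move=> z _; rewrite lee_fin ler_pXn2r ?nnegrE//.
    by case: (phi z) => ? ?; exact: sqrtr_ge0.
by rewrite integral_cst// [X in (_ * X)%E]probability_setT mule1 ltry.
Qed.

Lemma sqnorm_ge0 phi : (0 <= sqnorm phi)%E.
Proof. by apply: integral_ge0 => z _; rewrite lee_fin sqr_ge0. Qed.

Lemma L2_of_cont phi : circle_cont phi -> exists u : L2 R, u = phi %[ae haar].
Proof.
move=> cphi; have mphi := measurable_circle_fun cphi.
pose F : {mfun circle R >-> R[i]} := mfun_Sub (mem_set mphi).
have Ffin : (sqnorm (ae_class F) < +oo)%E by rewrite sqnorm_ae_class sqnorm_lty.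
by exists (MkL2 Ffin); exact: ae_classE F.
Qed.

(** A relation rather than a construction: this is all that is known of a vector picked by [opapp],
    and it determines inner products. *)
Definition single (k : int) phi (x : Hw R) : Prop :=
  forall n : int, x n = (fun z => phi z * (n == k)%:R) %[ae haar].

Lemma single_exists k phi : circle_cont phi -> exists x, single k phi x.
Proof.
move=> cphi; have [u uphi] := L2_of_cont cphi.
have c0 : circle_cont (fun=> 0) by exact: continuousC_cst.
have [v v0] := L2_of_cont c0.
pose F (n : int) := if n == k then u else v.
have sv : sqnorm v = 0%E.
  rewrite (@sqnorm_ae _ _ (fun=> 0))//.
  rewrite /sqnorm integral0_eq// => z _; congr EFin.
  by rewrite normc0 expr0n.
have Ffin : (\esum_(n in [set: int]) sqnorm (F n) < +oo)%E.
  rewrite (esumID [set k]); last by move=> n _; exact: sqnorm_ge0.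
  rewrite setTI esum_set1; last exact: sqnorm_ge0.
  rewrite {1}/F eqxx esum1 ?adde0; first exact: L2fin.
  by move=> n [_ /= /eqP/negPf nk]; rewrite /F nk.
exists (MkHw Ffin) => n /=; rewrite /F; case: ifPn => nk.
- by apply: filterS uphi => z + _ => ->//; rewrite mulr1.
- by apply: filterS v0 => z + _ => ->//; rewrite mulr0.
Qed.

Lemma single_ebasis k l : single k (fun z => (z : R[i]) ^ l) (ebasis R k l).
Proof. by move=> n; exact: ae_classE. Qed.

Lemma cint_ae g h : measurable_fun setT g -> measurable_fun setT h ->
  g = h %[ae haar] -> cint g = cint h.
Proof.
move=> /measurable_complexP[g1 g2] /measurable_complexP[h1 h2] gh.
rewrite /cint /Rintegral; congr (fine _ +i* fine _); apply: ae_eq_integral => //.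
- exact/measurable_EFinP.
- exact/measurable_EFinP.
- by apply: filterS gh => z + _ => ->.
- exact/measurable_EFinP.
- exact/measurable_EFinP.
- by apply: filterS gh => z + _ => ->.
Qed.

Lemma measurable_conj g : measurable_fun setT g ->
  measurable_fun setT (fun z => conjc (g z)).
Proof.
move=> /measurable_complexP[g1 g2]; apply/measurable_complexP; split.
- by rewrite (_ : (fun z => _) = fun z => Re (g z))//; apply/funext => z; case: (g z).
- rewrite (_ : (fun z => _) = fun z => - Im (g z)); first exact: measurableT_comp.
  by apply/funext => z; case: (g z).
Qed.

Lemma cint0 : cint (fun _ : circle R => 0) = 0 :> R[i].
Proof. by rewrite /cint /Rintegral /= !integral0. Qed.

Lemma innerL2_single k r phi psi x y (n : int) :
  circle_cont phi -> circle_cont psi -> single k phi x -> single r psi y ->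
  innerL2 (x n) (y n) =
    ((n == k) && (n == r))%:R * cint (fun z => phi z * conjc (psi z)).
Proof.
move=> cphi cpsi xphi ypsi.
have mphi := measurable_circle_fun cphi; have mpsi := measurable_circle_fun cpsi.
rewrite /innerL2 (@cint_ae _
  (fun z => (n == k)%:R * (n == r)%:R * (phi z * conjc (psi z)))).
- have [_|_] := eqVneq n k; last first.
    by under eq_fun do rewrite !mul0r; rewrite cint0 mul0r.
  have [_|_] := eqVneq n r; last first.
    by under eq_fun do rewrite mulr0 mul0r; rewrite cint0 mul0r.
  by under eq_fun do rewrite !mul1r; rewrite mul1r.
- by apply: measurable_complexM => //; exact: measurable_conj.
- apply: measurable_complexM; first exact: measurable_cst.
  by apply: measurable_complexM => //; exact: measurable_conj.
- apply: filterS2 (xphi n) (ypsi n) => z xz yz _; rewrite xz// yz//.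
  rewrite rmorphM /= conjc_nat; ring.
Qed.

(** The symmetric partial sums are constant from N = |k| on: only position k + N, which stands for
    the index k, can contribute. *)
Lemma innerHw_single k r phi psi x y :
  circle_cont phi -> circle_cont psi -> single k phi x -> single r psi y ->
  innerHw x y = cint (fun z => phi z * conjc (psi z)) * (k == r)%:R.
Proof.
move=> cphi cpsi xphi ypsi; set c := cint _.
have sumE N : (`|k| <= N)%N ->
    \sum_(i < N.*2.+1) innerL2 (x (i%:Z - N%:Z)) (y (i%:Z - N%:Z)) =
    c * (k == r)%:R.
  move=> kN; have jN : (absz (k + N%:Z)%R < N.*2.+1)%N by lia.
  rewrite (bigD1 (Ordinal jN))//= big1 ?addr0 => [|i ij].
    rewrite (innerL2_single _ cphi cpsi xphi ypsi).
    have -> : Posz (absz (k + N%:Z)) - N%:Z = k by lia.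
    by rewrite eqxx /= mulrC.
  rewrite (innerL2_single _ cphi cpsi xphi ypsi).
  case: eqP => [e|_]; last by rewrite mul0r.
  by case/eqP: ij; apply/val_inj => /=; lia.
rewrite /innerHw [RHS](_ : _ = Re (c * (k == r)%:R) +i* Im (c * (k == r)%:R)); last first.
  by case: (c * _).
by congr (_ +i* _); apply: cvg_lim => //; apply: cvg_near_cst;
  exists `|k|%N => // N /= kN; rewrite sumE.
Qed.

Lemma opappP (E : choiceType) (A : operator E) x : opdom A x -> A (x, opapp A x).
Proof. by move=> [y Axy]; apply: (@xgetPex _ x [set y | A (x, y)]); exists y. Qed.

End HilbertSpace.

(** * The operators on such vectors, and the three matrix coefficients *)

Section MatrixCoefficients.
Variable R : realType.
Import ComplexField.Normc complex.
Local Open Scope complex_scope.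
Local Open Scope classical_set_scope.
Variable f : circle_diffeo R.
Implicit Types (g phi psi : circle R -> R[i]).

(** A derivative known as a function v of the angle descends to the circle, since v t is [dtheta g]
    at e^it. *)
Lemma circle_C1_dtheta g (v : R -> R[i]) :
  (forall t, is_deriveC (fun x => g (expi x)) t (v t)) -> continuousC v ->
  circle_C1 g (dtheta g).
Proof.
move=> dg cv; have e t : dtheta g (expi t) = v t by exact: dthetaE (dg t).
split; first by move=> t; rewrite e.
by rewrite /circle_cont; under eq_fun do rewrite e.
Qed.

Lemma circle_C1M g g' h h' : circle_C1 g g' -> circle_C1 h h' ->
  circle_C1 (fun z => g z * h z) (fun z => g' z * h z + g z * h' z).
Proof.
move=> g1 h1; split.
  by move=> t; apply: is_deriveCM; [exact: g1.1|exact: h1.1].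
apply: continuousCD; apply: continuousCM.
- exact: g1.2.
- exact: circle_C1_cont h1.
- exact: circle_C1_cont g1.
- exact: h1.2.
Qed.

Lemma circle_C1_cst (c : R[i]) : circle_C1 (fun=> c) (fun=> 0).
Proof. by split; [move=> t; exact: is_deriveC_cst|exact: continuousC_cst]. Qed.

Lemma circle_C1_diffeo_exp h H (m : int) : diffeo_lift h H ->
  circle_C1 (fun z => (h z : R[i]) ^ m)
    (fun z => 'i%C * m%:~R * (speed h z)%:C * (h z : R[i]) ^ m).
Proof.
move=> lh; have cH := is_derive_continuous (lift_derive lh).
have [d2 dd2 _] := speed_C1 lh.
split.
- move=> t; under eq_fun do rewrite (lift_expi lh).
  by rewrite (lift_expi lh); apply: is_deriveC_expi_exp; exact: lift_derive lh t.
- apply: continuousCM; first apply: continuousCM.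
  + exact: continuousC_cst.
  + by apply: continuousC_real; exact: is_derive_continuous dd2.
  + by under eq_fun do rewrite (lift_expi lh); exact: continuousC_expi_exp.
Qed.

Lemma circle_C1_exp (m : int) :
  circle_C1 (fun z => (z : R[i]) ^ m) (fun z => 'i%C * m%:~R * (z : R[i]) ^ m).
Proof.
have := circle_C1_diffeo_exp m (diffeo_lift_id R); congr (circle_C1 _ _).
apply/funext => z; rewrite (_ : speed id z = 1) ?mulr1//.
by rewrite -(expi_carg z); apply: (@speedE _ _ id).
Qed.

Lemma circle_C1_speed_powR h H (b : R) : diffeo_lift h H ->
  exists g', circle_C1 (fun z => (speed h z `^ b)%:C) g'.
Proof.
move=> lh; have [d2 dd2 cd2] := speed_C1 lh.
have d (c t : R) : is_derive t 1 (fun x => speed h (expi x) `^ c)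
    (c * speed h (expi t) `^ (c - 1) * d2 t).
  have s0 := speed_gt0 lh (expi t).
  exact: (@is_derive1_comp _ (fun x => x `^ c) _ t _ _ (is_derive1_powR c s0) (dd2 t)).
exists (dtheta (fun z => (speed h z `^ b)%:C)).
apply: (@circle_C1_dtheta _ (fun t => (b * speed h (expi t) `^ (b - 1) * d2 t)%:C)).
  by move=> t; exact: is_deriveC_real (d b t).
apply: continuousC_real => t; apply: cvgM; last exact: cd2.
by apply: cvgM; [exact: cvg_cst|exact: is_derive_continuous (d (b - 1)) t].
Qed.

Lemma conjc_exp (z : circle R) (m : int) : conjc ((z : R[i]) ^ m) = (z : R[i]) ^ (- m).
Proof.
by rewrite -(expi_carg z) !expi_exp mulrNz mulNr /= cosN sinN.
Qed.

Lemma modop_single b k phi x y : single k phi x ->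
  modop f b (x, y) <-> single k (fun z => (delta f k z `^ b)%:C * phi z) y.
Proof.
move=> xphi; split=> h n.
- apply: filterS2 (h n) (xphi n) => z /= yE xE _; rewrite yE// xE//.
  by case: eqVneq => [->|_]; rewrite ?mulr1// !mulr0.
- apply: filterS2 (h n) (xphi n) => z /= yE xE _; rewrite yE// xE//.
  by case: eqVneq => [->|_]; rewrite ?mulr1// !mulr0.
Qed.

(** From left to right, the graph provides an unknown representative g; [AC_ae_eq] identifies it
    with the C^1 one, whose derivative is at hand. *)
Lemma Lop_single k phi phi' x y : circle_C1 phi phi' -> single k phi x ->
  Lop f (x, y) <-> single k (fun z => phi' z - (acoef f k)%:C * phi z) y.
Proof.
move=> phi1 xphi.
have C1n n : circle_C1 (fun z => phi z * (n == k)%:R) (fun z => phi' z * (n == k)%:R).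
  have := circle_C1M phi1 (circle_C1_cst (n == k)%:R).
  by congr (circle_C1 _ _); apply/funext => z; rewrite mulr0 addr0.
have E n (z : circle R) : 'i%C * (z : R[i]) * dz (fun z => phi z * (n == k)%:R) z -
    (acoef f n)%:C * (phi z * (n == k)%:R) =
    (phi' z - (acoef f k)%:C * phi z) * (n == k)%:R.
  rewrite (dz_C1 (C1n n)); case: eqVneq => [->|_].
    by rewrite !mulr1.
  by move: (acoef f n) (acoef f k) => a b; rewrite !mulr0 subr0.
split=> h n.
- have [g [[acg _] xg yg]] := h n.
  have gE : g = fun z => phi z * (n == k)%:R.
    apply: AC_ae_eq acg (AC_C1 (C1n n)) _.
    by apply: filterS2 xg (xphi n) => z /= -> // ->.
  by rewrite gE in yg; apply: filterS yg => z /= yE _; rewrite yE// E.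
- exists (fun z => phi z * (n == k)%:R); split.
  + split; first exact: AC_C1 (C1n n).
    apply: L2_of_cont.
    (* [H1] asks for D g in L^2, not for the angular derivative: D g = (i z)^-1 g' is continuous as
       well. *)
    have dzE (z : circle R) : dz (fun z => phi z * (n == k)%:R) z =
        ('i%C)^-1 * (z : R[i]) ^ (-1) * (phi' z * (n == k)%:R).
      rewrite -(dz_C1 (C1n n)) exprN1 mulrA -invfM mulVf ?mul1r//.
      by rewrite mulf_neq0 ?i_neq0 ?circle_neq0.
    rewrite /circle_cont; under eq_fun do rewrite dzE.
    apply: continuousCM; last exact: (C1n n).2.
    exact: continuousCM (continuousC_cst _) (circle_C1_cont (circle_C1_exp _)).
  + exact: xphi.
  + by apply: filterS (h n) => z /= yE _; rewrite yE// E.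
Qed.

Lemma modconj_single k phi x y : orientation_preserving f -> single k phi x ->
  modconj f (x, y) <-> single (- k) (fun z => (delta f (- k) z `^ 2^-1)%:C *
    conjc (phi (iterz f (- k) z))) y.
Proof.
move=> fo xphi.
have xn n : \forall z \ae haar, x (- n) (iterz f n z) =
    phi (iterz f n z) * (n == - k)%:R.
  have [H lH] := diffeo_lift_iterz n fo.
  have := ae_haar_diffeo lH (xphi (- n)); apply: filterS => z ->//.
  by rewrite eqr_oppLR.
split=> h n.
- apply: filterS2 (h n) (xn n) => z /= yE xE _; rewrite yE// xE.
  by case: eqVneq => [->|_]; rewrite ?mulr1// !mulr0 conjc0 mulr0.
- apply: filterS2 (h n) (xn n) => z /= yE xE _; rewrite yE// xE.
  by case: eqVneq => [->|_]; rewrite ?mulr1// !mulr0 conjc0 mulr0.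
Qed.

Hypothesis f_orient : orientation_preserving f.

Lemma delta_gt0 n z : 0 < delta f n z.
Proof. by have [H lH] := diffeo_lift_iterz n f_orient; exact: speed_gt0 lH z. Qed.

Lemma delta_powR_C1 n b : exists g', circle_C1 (fun z => (delta f n z `^ b)%:C) g'.
Proof.
by have [H lH] := diffeo_lift_iterz n f_orient; exact: circle_C1_speed_powR lH.
Qed.

Lemma delta_powR_cont n b : circle_cont (fun z => (delta f n z `^ b)%:C).
Proof. by have [g' /circle_C1_cont] := delta_powR_C1 n b. Qed.

Lemma delta_cont n : circle_cont (fun z => (delta f n z)%:C).
Proof.
rewrite (_ : (fun z => _) = fun z => (delta f n z `^ 1)%:C).
  exact: delta_powR_cont.
by apply/funext => z; rewrite powRr1// ltW// delta_gt0.
Qed.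

Lemma exp_cont (m : int) : circle_cont (fun z => (z : R[i]) ^ m).
Proof. exact: circle_C1_cont (circle_C1_exp m). Qed.

Lemma iterz_exp_cont n (m : int) : circle_cont (fun z => (iterz f n z : R[i]) ^ m).
Proof.
have [H lH] := diffeo_lift_iterz n f_orient.
exact: circle_C1_cont (circle_C1_diffeo_exp m lH).
Qed.

Lemma fourier_delta_inv k l s :
  fourier (fun z => ((delta f k z)^-1)%:C) (s - l) =
  cint (fun z => (delta f k z `^ (-1))%:C * (z : R[i]) ^ l * conjc ((z : R[i]) ^ s)).
Proof.
congr cint; apply/funext => z; rewrite conjc_exp opprB expfzDr ?circle_neq0//.
by rewrite powR_inv1 ?ltW ?delta_gt0// mulrA.
Qed.

(** The vector [ebasis R k l] is an eigenvector of L for i l - a_k, and this scalar comes out of the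
    integral. *)
Lemma coeff_DeltaL k l r s :
  let A := opcomp (modop f (-1)) (Lop f) in
  opdom A (ebasis R k l) /\
  innerHw (opapp A (ebasis R k l)) (ebasis R r s) =
    ('i%C * l%:~R - (acoef f k)%:C) *
    fourier (fun z => ((delta f k z)^-1)%:C) (s - l) * (k == r)%:R.
Proof.
move=> A; set c := 'i%C * l%:~R - (acoef f k)%:C.
have e1 := single_ebasis R k l; have er := single_ebasis R r s.
pose phi (z : circle R) : R[i] :=
  'i%C * l%:~R * (z : R[i]) ^ l - (acoef f k)%:C * (z : R[i]) ^ l.
have phiE z : phi z = c * (z : R[i]) ^ l by rewrite /c mulrBl.
have cphi : circle_cont phi.
  rewrite (_ : phi = fun z => c * (z : R[i]) ^ l); last exact/funext.
  exact: continuousCM (continuousC_cst _) (exp_cont l).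
pose psi (z : circle R) : R[i] := (delta f k z `^ (-1))%:C * phi z.
have cpsi : circle_cont psi by exact: continuousCM (delta_powR_cont k (-1)) cphi.
have domA : opdom A (ebasis R k l).
  have [y yphi] := single_exists k cphi; have [w wpsi] := single_exists k cpsi.
  exists w, y; first exact/(Lop_single _ (circle_C1_exp l) e1).
  exact/(modop_single _ _ yphi).
split=> //; have [y /= /(Lop_single _ (circle_C1_exp l) e1) yphi] := opappP domA.
move=> /(modop_single _ _ yphi) wpsi.
rewrite (innerHw_single cpsi (exp_cont s) wpsi er); congr (_ * _).
rewrite fourier_delta_inv -cintZ; last first.
  apply: continuousCM; last exact: continuousC_conj (exp_cont s).
  exact: continuousCM (delta_powR_cont k (-1)) (exp_cont l).
by congr cint; apply/funext => z; rewrite /psi phiE; ring.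
Qed.

(** Integration by parts moves the derivative from delta_k^-1 z^l to z^-s, which yields i s; the
    derivative of delta_k^-1 is never computed. *)
Lemma coeff_LDelta k l r s :
  let A := opcomp (Lop f) (modop f (-1)) in
  opdom A (ebasis R k l) /\
  innerHw (opapp A (ebasis R k l)) (ebasis R r s) =
    ('i%C * s%:~R - (acoef f k)%:C) *
    fourier (fun z => ((delta f k z)^-1)%:C) (s - l) * (k == r)%:R.
Proof.
move=> A.
have e1 := single_ebasis R k l; have er := single_ebasis R r s.
pose phi (z : circle R) : R[i] := (delta f k z `^ (-1))%:C * (z : R[i]) ^ l.
have cphi : circle_cont phi by exact: continuousCM (delta_powR_cont k (-1)) (exp_cont l).
have [d' d1] := delta_powR_C1 k (-1).
have [phi' phi1] : exists phi', circle_C1 phi phi'.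
  by eexists; exact: circle_C1M d1 (circle_C1_exp l).
pose psi (z : circle R) : R[i] := phi' z - (acoef f k)%:C * phi z.
have cpsi : circle_cont psi.
  rewrite (_ : psi = fun z => phi' z + (- (acoef f k)%:C) * phi z).
    by apply: continuousCD phi1.2 _; exact: continuousCM (continuousC_cst _) cphi.
  by apply/funext => z; rewrite mulNr.
have domA : opdom A (ebasis R k l).
  have [y yphi] := single_exists k cphi; have [w wpsi] := single_exists k cpsi.
  exists w, y; first exact/(modop_single _ _ e1).
  exact/(Lop_single _ phi1 yphi).
split=> //; have [y /= /(modop_single _ _ e1) yphi] := opappP domA.
move=> /(Lop_single _ phi1 yphi) wpsi.
rewrite (innerHw_single cpsi (exp_cont s) wpsi er); congr (_ * _).
rewrite fourier_delta_inv -/phi.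
have cs := exp_cont (- s).
have cphis : circle_cont (fun z => phi z * (z : R[i]) ^ (- s)).
  exact: continuousCM cphi cs.
have := circle_C1M phi1 (circle_C1_exp (- s)) => -[dprod cprod].
have := @cint_derive _ (fun z => phi z * (z : R[i]) ^ (- s))
  (fun z => phi' z * (z : R[i]) ^ (- s) +
    phi z * ('i%C * (- s)%:~R * (z : R[i]) ^ (- s))) dprod cprod.
rewrite cintD; [|exact: continuousCM phi1.2 cs|
  exact: continuousCM cphi (circle_C1_exp (- s)).2].
rewrite [X in _ + X](_ : _ =
  'i%C * (- s)%:~R * cint (fun z => phi z * (z : R[i]) ^ (- s))); last first.
  by rewrite -cintZ//; congr cint; apply/funext => z; ring.
move=> /eqP; rewrite addr_eq0 => /eqP parts.
have -> : (fun z => (delta f k z `^ (-1))%:C * (z : R[i]) ^ l * conjc ((z : R[i]) ^ s)) =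
    fun z => phi z * (z : R[i]) ^ (- s).
  by apply/funext => z; rewrite conjc_exp.
have -> : (fun z => psi z * conjc ((z : R[i]) ^ s)) =
    fun z => phi' z * (z : R[i]) ^ (- s) +
      (- (acoef f k)%:C) * (phi z * (z : R[i]) ^ (- s)).
  by apply/funext => z; rewrite conjc_exp /psi; ring.
rewrite cintD; [|exact: continuousCM phi1.2 cs|
  exact: continuousCM (continuousC_cst _) cphis].
by rewrite parts cintZ// mulrNz; ring.
Qed.

Lemma single_epsbasis k l :
  single (- k) (fun z => (delta f (- k) z `^ 2^-1)%:C * (iterz f (- k) z : R[i]) ^ (- l))
    (epsbasis f k l).
Proof.
have cpsi : circle_cont (fun z => (delta f (- k) z `^ 2^-1)%:C *
    conjc ((iterz f (- k) z : R[i]) ^ l)).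
  apply: continuousCM (delta_powR_cont _ _) _.
  exact: continuousC_conj (iterz_exp_cont _ _).
have [y ypsi] := single_exists (- k) cpsi.
have domJ : opdom (modconj f) (ebasis R k l).
  by exists y; apply/(modconj_single _ f_orient (single_ebasis R k l)).
have := opappP domJ; move=> /(modconj_single _ f_orient (single_ebasis R k l)).
congr (single _ _ _); apply/funext => z.
by rewrite conjc_exp.
Qed.

(** The first half power cancels the one in epsilon^{kl}, so L acts on (f^-k)^-l; the second cancels
    the one in epsilon^{rs}. The derivative leaves a factor delta_{-k}, exactly the Jacobian that
    the change of variables absorbs. *)
Lemma coeff_symmetric k l r s :
  let A := opcomp (modop f (- 2^-1)) (opcomp (Lop f) (modop f (- 2^-1))) in
  opdom A (epsbasis f k l) /\
  innerHw (opapp A (epsbasis f k l)) (epsbasis f r s) =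
    - ('i%C * l%:~R * (l == s)%:R +
       (acoef f (- k))%:C * fourier (fun z => (delta f k z)%:C) (l - s))
    * (k == r)%:R.
Proof.
move=> A; have [H lH] := diffeo_lift_iterz (- k) f_orient.
have e1 := single_epsbasis k l; have er := single_epsbasis r s.
pose h := iterz f (- k); pose d := delta f (- k); pose a := (acoef f (- k))%:C.
pose phi (z : circle R) : R[i] := (h z : R[i]) ^ (- l).
have halves z : d z `^ (- 2^-1) * d z `^ 2^-1 = 1.
  by rewrite powRN mulVf// gt_eqF// powR_gt0// delta_gt0.
have phiE : (fun z => (d z `^ (- 2^-1))%:C *
    ((d z `^ 2^-1)%:C * (h z : R[i]) ^ (- l))) = phi.
  by apply/funext => z; rewrite mulrA -rmorphM /= halves mul1r.
have phi1 := circle_C1_diffeo_exp (- l) lH.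
pose phi2 (z : circle R) : R[i] :=
  'i%C * (- l)%:~R * (speed h z)%:C * (h z : R[i]) ^ (- l) - a * phi z.
have cphi : circle_cont phi by exact: iterz_exp_cont.
have cphi2 : circle_cont phi2.
  rewrite (_ : phi2 = fun z =>
    ('i%C * (- l)%:~R * (speed h z)%:C * (h z : R[i]) ^ (- l)) + (- a) * phi z).
    by apply: continuousCD phi1.2 _; exact: continuousCM (continuousC_cst _) cphi.
  by apply/funext => z; rewrite mulNr.
pose psi (z : circle R) : R[i] := (d z `^ (- 2^-1))%:C * phi2 z.
have cpsi : circle_cont psi by exact: continuousCM (delta_powR_cont _ _) cphi2.
have domA : opdom A (epsbasis f k l).
  have [y yphi] := single_exists (- k) cphi; have [w wphi2] := single_exists (- k) cphi2.
  have [u upsi] := single_exists (- k) cpsi.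
  exists u, w; last exact/(modop_single _ _ wphi2).
  exists y; first by apply/(modop_single _ _ e1); rewrite phiE.
  exact/(Lop_single _ phi1 yphi).
split=> //; have [w /= [y /=]] := opappP domA.
move=> /(modop_single _ _ e1); rewrite phiE => yphi.
move=> /(Lop_single _ phi1 yphi) wphi2 /(modop_single _ _ wphi2) upsi.
have ceps n m :
    circle_cont (fun z => (delta f n z `^ 2^-1)%:C * (iterz f n z : R[i]) ^ m).
  exact: continuousCM (delta_powR_cont _ _) (iterz_exp_cont _ _).
rewrite (innerHw_single cpsi (ceps _ _) upsi er) eqr_opp.
have [<-{er}|_] := eqVneq k r; last by rewrite !mulr0.
rewrite !mulr1 -/h -/d.
pose g (z : circle R) : R[i] := (z : R[i]) ^ (s - l).
have cg : circle_cont g by exact: exp_cont.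
have cgh : circle_cont (fun z => g (h z)) by exact: iterz_exp_cont.
have cdgh : circle_cont (fun z => (d z)%:C * g (h z)).
  exact: continuousCM (delta_cont _) cgh.
have change g' : circle_cont g' -> cint (fun z => (d z)%:C * g' (h z)) = cint g'.
  move=> cg'; have [d2 dd2 _] := speed_C1 lH.
  apply: (cint_change (lift_expi lH) (lift_homo lH) _ (lift_derive lH)) => //.
    by rewrite -[2 * pi in LHS]add0r (lift_period lH).
  exact: is_derive_continuous dd2.
have -> : (fun z => psi z * conjc ((d z `^ 2^-1)%:C * (h z : R[i]) ^ (- s))) =
    fun z => (- ('i%C * l%:~R)) * ((d z)%:C * g (h z)) + (- a) * g (h z).
  apply/funext => z.
  rewrite (_ : conjc _ = (d z `^ 2^-1)%:C * (h z : R[i]) ^ s); last first.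
    by rewrite rmorphM /= conjc_exp opprK oppr0.
  rewrite /psi /phi2 /phi /g.
  rewrite expfzDr ?circle_neq0// mulrNz.
  have := congr1 (fun x => x%:C) (halves z); rewrite rmorphM rmorph1 /= => hz.
  have E (p q c e b v u : R[i]) : p * (- c * e * v - b * v) * (q * u) =
      p * q * (- c * (e * (u * v)) + - b * (u * v)) by ring.
  have sd : speed h z = d z by [].
  by rewrite mulrN sd E hz mul1r.
rewrite cintD; [|exact: continuousCM (continuousC_cst _) cdgh|
  exact: continuousCM (continuousC_cst _) cgh].
rewrite !cintZ// change// cint_exp.
(* No Jacobian is present in this term: inserting delta_k(h z) * d z = 1 supplies it and leaves
   delta_k under the integral. *)
have -> : cint (fun z => g (h z)) = fourier (fun z => (delta f k z)%:C) (l - s).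
  have cdg : circle_cont (fun z => (delta f k z)%:C * g z).
    exact: continuousCM (delta_cont k) cg.
  rewrite /fourier opprB -(change _ cdg); congr cint; apply/funext => z.
  have := speed_iterzN (- k) z f_orient; rewrite opprK mulrC => dd.
  by rewrite mulrA -rmorphM /= dd mul1r.
rewrite subr_eq0 [s == l]eq_sym -/a; ring.
Qed.

End MatrixCoefficients.

Theorem proposition7p3 (R : realType) (alpha : R) (f : circle_diffeo R)
    (alpha_itv : 0 < alpha < 2^-1) (alpha_irr : irrational alpha)
    (f_orient : orientation_preserving f)
    (f_rot : has_rotation_number f (2 * alpha)) :
  forall k l r s : int,
  [/\ let A := opcomp (modop f (-1)) (Lop f) in
      opdom A (ebasis R k l) /\
      innerHw (opapp A (ebasis R k l)) (ebasis R r s) =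
        ('i%C * l%:~R - (acoef f k)%:C%C) *
        fourier (fun z => ((delta f k z)^-1)%:C%C) (s - l) * (k == r)%:R,
      let A := opcomp (Lop f) (modop f (-1)) in
      opdom A (ebasis R k l) /\
      innerHw (opapp A (ebasis R k l)) (ebasis R r s) =
        ('i%C * s%:~R - (acoef f k)%:C%C) *
        fourier (fun z => ((delta f k z)^-1)%:C%C) (s - l) * (k == r)%:R &
      let A := opcomp (modop f (- 2^-1)) (opcomp (Lop f) (modop f (- 2^-1))) in
      opdom A (epsbasis f k l) /\
      innerHw (opapp A (epsbasis f k l)) (epsbasis f r s) =
        - ('i%C * l%:~R * (l == s)%:R +
           (acoef f (- k))%:C%C * fourier (fun z => (delta f k z)%:C%C) (l - s))
        * (k == r)%:R].
Proof.
move=> k l r s; split.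
- exact: coeff_DeltaL.
- exact: coeff_LDelta.
- exact: coeff_symmetric.
Qed.
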